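(* Let $f\in C^2(\mathbb{T}^n)$. Then, for each $x\in\mathbb{T}^n$, $$\lim_{\sigma\to2^-}(-\Delta)^{\sigma/2}f(x)=-\Delta f(x).$$
   Context: $\mathbb{T}^n$, $n\ge1$, is the torus $\mathbb{R}^n/2\pi\mathbb{Z}^n$. With $c_\nu(f)=\frac1{(2\pi)^n}\int_{\mathbb{T}^n}f(x)e^{-i\nu\cdot x}dx$, the fractional Laplacian of a smooth function is $(-\Delta)^{\sigma/2}f(x)=\sum_{\nu\in\mathbb{Z}^n}|\nu|^\sigma c_\nu(f)e^{i\nu\cdot x}$; for $f\in L^1(\mathbb{T}^n)$ it is the periodic distribution $\phi\mapsto\int_{\mathbb{T}^n}f(-\Delta)^{\sigma/2}\phi\,dx$, $\phi\in C^\infty(\mathbb{T}^n)$. For $f\in C^2(\mathbb{T}^n)$ and $0<\sigma<2$ this distribution is a continuous function, whose values (denoted $(-\Delta)^{\sigma/2}f(x)$) are given by $\frac1{\Gamma(-\sigma/2)}\int_0^\infty\big(e^{t\Delta}f(x)-f(x)\big)\frac{dt}{t^{1+\sigma/2}}$, where $e^{t\Delta}f(x)=\sum_{\nu\in\mathbb{Z}^n}e^{-t|\nu|^2}c_\nu(f)e^{i\nu\cdot x}$. *)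

(* Defs.v *)
From mathcomp Require Import all_boot all_order all_algebra complex.
From mathcomp Require Import all_classical all_reals all_analysis summability.

Set Implicit Arguments.
Unset Strict Implicit.
Unset Printing Implicit Defensive.

Import Order.TTheory GRing.Theory Num.Theory.
Import numFieldNormedType.Exports.

Local Open Scope classical_set_scope.
Local Open Scope ring_scope.
Local Open Scope complex_scope.

(* A function on the torus R^n / 2 pi Z^n is encoded as a function on R^n which
   is 2 pi-periodic in each coordinate. *)
Definition periodic {R : realType} {n : nat} (f : 'rV[R]_n -> R[i]) : Prop :=
  forall (x : 'rV[R]_n) (i : 'I_n), f (x + (2 * pi) *: delta_mx 0 i) = f x.

Definition partially_derivable {R : realType} {n : nat} (i : 'I_n)
    (f : 'rV[R]_n -> R[i]) : Prop :=
  forall x : 'rV[R]_n, derivable (@complex.Re R \o f) x (delta_mx 0 i) /\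
                       derivable (@complex.Im R \o f) x (delta_mx 0 i).

(* Componentwise, because R[i]^o is a normed module over R[i] and not over R. *)
Definition partial {R : realType} {n : nat} (i : 'I_n)
    (f : 'rV[R]_n -> R[i]) : 'rV[R]_n -> R[i] :=
  fun x => 'D_(delta_mx 0 i) (@complex.Re R \o f) x
        +i* 'D_(delta_mx 0 i) (@complex.Im R \o f) x.

(* The regular module R[i]^o carries the topology given by the modulus. *)
Fixpoint class_C {R : realType} {n : nat} (k : nat)
    (f : 'rV[R]_n -> R[i]) : Prop :=
  continuous (f : 'rV[R]_n -> R[i]^o) /\
  (if k is k'.+1 then
     forall i : 'I_n, partially_derivable i f /\ class_C k' (partial i f)
   else True).

Definition torus_C {R : realType} {n : nat} (k : nat)
    (f : 'rV[R]_n -> R[i]) : Prop := periodic f /\ class_C k f.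

Definition torus_smooth {R : realType} {n : nat}
    (f : 'rV[R]_n -> R[i]) : Prop := forall k : nat, torus_C k f.

Definition laplacian {R : realType} {n : nat}
    (f : 'rV[R]_n -> R[i]) : 'rV[R]_n -> R[i] :=
  fun x => \sum_(i < n) partial i (partial i f) x.

(* Iterated integral over [0, 2 pi]^n; it is only applied to continuous
   functions. *)
Fixpoint torus_Rint {R : realType} (n : nat) : ('rV[R]_n -> R) -> R :=
  match n with
  | 0%N => fun f => f 0
  | m.+1 => fun f =>
      \int[lebesgue_measure]_(t in `[0, 2 * pi])
         torus_Rint (fun y : 'rV[R]_m => f (row_mx (const_mx t : 'rV_1) y))
  end.

Definition torus_int {R : realType} {n : nat} (f : 'rV[R]_n -> R[i]) : R[i] :=
  torus_Rint (@complex.Re R \o f) +i* torus_Rint (@complex.Im R \o f).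

Definition expi {R : realType} (t : R) : R[i] := cos t +i* sin t.

Definition freq_dot {R : realType} {n : nat} (nu : 'rV[int]_n)
    (x : 'rV[R]_n) : R := \sum_(j < n) (nu 0 j)%:~R * x 0 j.

Definition freq_norm {R : realType} {n : nat} (nu : 'rV[int]_n) : R :=
  Num.sqrt (\sum_(j < n) (nu 0 j)%:~R ^+ 2).

Definition fourier_coef {R : realType} {n : nat} (f : 'rV[R]_n -> R[i])
    (nu : 'rV[int]_n) : R[i] :=
  ((2 * pi) ^- n)%:C * torus_int (fun x => f x * expi (- freq_dot nu x)).

(* [sum] is the unordered sum (limit along the finite subsets of Z^n). *)
Definition frac_lap_smooth {R : realType} {n : nat} (s : R)
    (phi : 'rV[R]_n -> R[i]) : 'rV[R]_n -> R[i] :=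
  fun x => sum (fun nu : 'rV[int]_n =>
    (freq_norm nu `^ s)%:C * fourier_coef phi nu * expi (freq_dot nu x) : R[i]^o).

Definition frac_lap_distr {R : realType} {n : nat} (s : R)
    (f : 'rV[R]_n -> R[i]) (phi : 'rV[R]_n -> R[i]) : R[i] :=
  torus_int (fun x => f x * frac_lap_smooth s phi x).

Definition fun_distr {R : realType} {n : nat}
    (g : 'rV[R]_n -> R[i]) (phi : 'rV[R]_n -> R[i]) : R[i] :=
  torus_int (fun x => g x * phi x).

(* The continuous function with which the distribution is identified (unique
   when it exists, and an arbitrary value otherwise). *)
Definition frac_lap {R : realType} {n : nat} (s : R)
    (f : 'rV[R]_n -> R[i]) : 'rV[R]_n -> R[i] :=
  get [set g : 'rV[R]_n -> R[i]^o | torus_C 0 g /\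
    forall phi : 'rV[R]_n -> R[i], torus_smooth phi ->
      frac_lap_distr s f phi = fun_distr g phi].

(* Main.v *)
(* Put A = - Laplacian, and let sigma_N f be the Fejer means of f.  For every
   trigonometric polynomial p and every 0 < s < 2,
     sup |A^(s/2) p| <= 2 sup |p| + sup |A p|,
   with constants that do not depend on s.  As sigma_N f -> f and
   A (sigma_N f) = sigma_N (A f) -> A f uniformly, A^(s/2) (sigma_N f) converges
   uniformly on the torus, and uniformly in s, to a continuous function, which
   represents the distribution (-Laplacian)^(s/2) f; on trigonometric polynomials
   the limit s -> 2 is a finite computation, and the two limits commute.

   The inequality comes from the resolvent bound sup |(t + A)^-1 p| <= sup |p| / t,
   which is the triangle inequality for the difference Laplacian, and from
     l^(1/b) * \int_0^oo 1/(1 + v^b) dv = \int_0^oo l/(l + v^b) dv   (b = 2/s):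
   the norm of A (v^b + A)^-1 p is at most (2 sup |p| + sup |A p|)/(1 + v^b), so that
   the value of the integral on the left cancels. *)

Require Import Defs.
From mathcomp Require Import all_boot all_order all_algebra complex finmap.
From mathcomp Require Import all_classical all_reals all_analysis summability.
From mathcomp Require Import measurable_realfun ring lra.

Set Implicit Arguments.
Unset Strict Implicit.
Unset Printing Implicit Defensive.

Import Order.TTheory GRing.Theory Num.Theory.
Import numFieldNormedType.Exports.
Import Normc.

Local Open Scope classical_set_scope.
Local Open Scope ring_scope.
Local Open Scope complex_scope.

Local Notation Re := (@complex.Re _).
Local Notation Im := (@complex.Im _).

(** * Moduli and exponentials in R[i] *)

Section ComplexModulus.
Context {R : realType}.
Implicit Types (z w : R[i]) (r : R).

(** For f merely of class C^2 the Fourier series of A f, the Fourier series of a continuous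
    function, may diverge, so the limit cannot be taken term by term. Fejer means replace partial
    sums because their kernel is nonnegative, which gives uniform convergence for every continuous
    function. Moreover [frac_lap] is a choice among representatives and carries no formula: nothing
    is known of its value until a continuous representative is produced for each s and shown to be
    unique. It arises as the limit of A^(s/2) (sigma_N f), and the rate must not depend on s if s ->
    2 is to be exchanged with N -> oo. Integral formulas for A^(s/2) have prefactors that depend on
    s; comparing the integral at l with the same integral at 1 makes the prefactor irrelevant.
    Integrals over the torus are iterated one-dimensional integrals, so linearity, positivity and
    translation invariance are obtained by induction on n, one coordinate at a time, and the order
    of integration is never exchanged. *)

Lemma normc_normE z : `|z| = (normc z)%:C.
Proof. by rewrite normc_def; case: z. Qed.

Lemma normc_ge0 z : 0 <= normc z.
Proof. by case: z => a b /=; rewrite sqrtr_ge0. Qed.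

Lemma normcD z w : normc (z + w) <= normc z + normc w.
Proof. exact: (@le_normcD R z w). Qed.

Lemma normcB z w : normc (z - w) = normc (w - z).
Proof. by rewrite -opprB; exact: (@normcN R (w - z)). Qed.

Lemma normc_dist (y z w : R[i]) :
  normc (z - w) <= normc (z - y) + normc (y - w).
Proof. by apply: le_trans (normcD _ _); rewrite addrA subrK. Qed.

Lemma normc_sum (I : Type) (s : seq I) (P : pred I) (F : I -> R[i]) :
  normc (\sum_(j <- s | P j) F j) <= \sum_(j <- s | P j) normc (F j).
Proof.
elim/big_rec2: _ => [|j b a _ ab]; first by rewrite normc0.
by apply: le_trans (normcD _ _) _; rewrite lerD2l.
Qed.

Lemma normc_real r : normc r%:C = `|r|.
Proof. by rewrite /= expr0n /= addr0 sqrtr_sqr. Qed.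

Lemma normc_sqr z : normc z ^+ 2 = Re z ^+ 2 + Im z ^+ 2.
Proof. by case: z => a b /=; rewrite sqr_sqrtr ?addr_ge0 ?sqr_ge0. Qed.

Lemma ler_Re_normc z : `|Re z| <= normc z.
Proof.
by rewrite -ler_sqr ?nnegrE ?normc_ge0// normc_sqr real_normK ?num_real//
  lerDl sqr_ge0.
Qed.

Lemma ler_Im_normc z : `|Im z| <= normc z.
Proof.
by rewrite -ler_sqr ?nnegrE ?normc_ge0// normc_sqr real_normK ?num_real//
  lerDr sqr_ge0.
Qed.

Lemma normc_le_ReIm z : normc z <= `|Re z| + `|Im z|.
Proof.
rewrite -ler_sqr ?nnegrE ?normc_ge0 ?addr_ge0// normc_sqr sqrrD.
by rewrite !real_normK ?num_real// lerD2r lerDl mulrn_wge0// mulr_ge0.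
Qed.

Lemma normc_conj z : normc z^* = normc z.
Proof. by case: z => a b /=; rewrite sqrrN. Qed.

Lemma mulc_conj z : z * z^* = (normc z ^+ 2)%:C.
Proof.
rewrite normc_sqr; case: z => a b /=.
by apply/eqP; rewrite eq_complex /=; apply/andP; split; apply/eqP; ring.
Qed.

(** For nonzero z, w is the conjugate of z divided by its modulus. Rotating by w turns bounds on
    moduli of sums and integrals into real inequalities. *)
Lemma normc_phase z : exists2 w, normc w = 1 & w * z = (normc z)%:C.
Proof.
have [->|z0] := eqVneq z 0; first by exists 1; rewrite ?normc1// mulr0 normc0.
have nz0 : normc z != 0 by apply: contra z0 => /eqP/eq0_normc ->.
exists ((normc z)^-1%:C * z^*).
  rewrite normcM normc_real normc_conj ger0_norm ?invr_ge0 ?normc_ge0//.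
  by rewrite mulVf.
by rewrite -mulrA [_^* * _]mulrC mulc_conj -rmorphM /= expr2 mulKf.
Qed.

Lemma Re_real_mul r z : Re (r%:C * z) = r * Re z.
Proof. by case: z => a b /=; rewrite mul0r subr0. Qed.

Lemma Im_real_mul r z : Im (r%:C * z) = r * Im z.
Proof. by case: z => a b /=; rewrite mul0r addr0. Qed.

Lemma cReD z w : Re (z + w) = Re z + Re w.
Proof. by case: z => a b; case: w => c d. Qed.

Lemma cImD z w : Im (z + w) = Im z + Im w.
Proof. by case: z => a b; case: w => c d. Qed.

Lemma cReM z w : Re (z * w) = Re z * Re w - Im z * Im w.
Proof. by case: z => a b; case: w => c d. Qed.

Lemma cImM z w : Im (z * w) = Re z * Im w + Im z * Re w.
Proof. by case: z => a b; case: w => c d. Qed.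

Lemma cRe_sum (I : Type) (s : seq I) (F : I -> R[i]) :
  Re (\sum_(j <- s) F j) = \sum_(j <- s) Re (F j).
Proof. by elim/big_rec2: _ => [//|j b a _ <-]; rewrite cReD. Qed.

Lemma complexP z w : Re z = Re w -> Im z = Im w -> z = w.
Proof. by case: z => a b; case: w => c d /= -> ->. Qed.

Lemma cvgcP (T : Type) (F : set_system T) {FF : Filter F} (f : T -> R[i]^o)
    (l : R[i]^o) :
  f @ F --> l <-> forall e : R, 0 < e -> \forall t \near F, normc (l - f t) <= e.
Proof.
split=> [/cvgrPdist_le fl e e0|fl].
  have := fl e%:C; rewrite ltcR => /(_ e0); apply: filterS => t.
  by rewrite normc_normE lecR.
(* In the order of R[i] a positive radius is real: its imaginary part e' is 0. *)
apply/cvgrPdist_le => -[e e'] /=; rewrite ltcE /= => /andP[/eqP -> e0].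
by have := fl e e0; apply: filterS => t; rewrite normc_normE -lecR.
Qed.

Lemma expi0 : expi 0 = 1 :> R[i].
Proof. by rewrite /expi sin0 cos0. Qed.

Lemma expiD (a b : R) : expi (a + b) = expi a * expi b.
Proof. by rewrite /expi cosD sinD; apply: complexP => //=; ring. Qed.

Lemma normc_expi (a : R) : normc (expi a) = 1.
Proof. by rewrite /= cos2Dsin2 sqrtr1. Qed.

Lemma expi_conj (a : R) : (expi a)^* = expi (- a).
Proof. by rewrite /expi cosN sinN. Qed.

Lemma expi_mul2pi_int (a : R) (m : int) : expi (a + m%:~R * (2 * pi)) = expi a.
Proof.
have expi_nat k b : expi (b + k%:R * (2 * pi)) = expi b :> R[i].
  elim: k b => [|k IH] b; first by rewrite mul0r addr0.
  rewrite -natr1 mulrDl addrA mul1r expiD IH /expi.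
  by rewrite mulr_natl cos2pi sin2pi mulr1.
case: m => k; first exact: expi_nat.
rewrite NegzE mulrNz mulNr -[in RHS](subrK (k.+1%:R * (2 * pi)) a).
by rewrite expi_nat.
Qed.

End ComplexModulus.

(** * Integrals over a period *)

Section RealLine.
Context {R : realType}.
Local Notation mu := (@lebesgue_measure R).

Definition intT (G : R -> R) : R := \int[mu]_(t in `[0, 2 * pi]) G t.

Lemma twopi_gt0 : 0 < 2 * pi :> R.
Proof. by rewrite mulr_gt0 ?pi_gt0. Qed.

Lemma integrable_segment (G : R -> R) (a b : R) :
  continuous G -> mu.-integrable `[a, b] (EFin \o G).
Proof.
move=> cG; apply: continuous_compact_integrable; first exact: segment_compact.
exact: continuous_subspaceT.
Qed.

Lemma intT_linear (c : R) (G H : R -> R) : continuous G -> continuous H ->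
  intT (fun t => c * G t + H t) = c * intT G + intT H.
Proof.
move=> cG cH; rewrite /intT RintegralD//.
- rewrite RintegralZl//; exact: integrable_segment.
- by apply: integrable_segment => t; exact: (cvgM (cvg_cst _) (cG t)).
- exact: integrable_segment.
Qed.

Lemma ler_intT (G H : R -> R) : continuous G -> continuous H ->
  (forall t, G t <= H t) -> intT G <= intT H.
Proof.
by move=> cG cH GH; apply: le_Rintegral => //; exact: integrable_segment.
Qed.

Lemma intT_cst (c : R) : intT (fun=> c) = 2 * pi * c.
Proof.
rewrite /intT Rintegral_cst//= lebesgue_measure_itv /= lte_fin twopi_gt0.
by rewrite oppr0 adde0 /= mulrC.
Qed.

Lemma antiderivative (G : R -> R) (a : R) : continuous G ->
  exists F : R -> R, forall x, a < x -> is_derive x 1 F (G x).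
Proof.
move=> cG; exists (fun x => \int[mu]_(t in [set` Interval (BLeft a) (BRight x)]) G t).
move=> x ax; have [] := @continuous_FTC1_closed R G a x (x + 1) _ _ ax (cG x).
- by rewrite ltrDl.
- exact: integrable_segment.
- by move=> dF FG; exact: (DeriveDef dF (etrans (esym (derive1E _ _)) FG)).
Qed.

Lemma FTC2 (G F : R -> R) (a b : R) : a < b -> continuous G ->
  (forall x, a <= x <= b -> is_derive x 1 F (G x)) ->
  \int[mu]_(t in `[a, b]) G t = F b - F a.
Proof.
move=> ab cG dF.
have cF (x : R) : a <= x <= b -> {for x, continuous F}.
  move=> /dF dFx; apply: differentiable_continuous.
  by apply/derivable1_diffP; exact: ex_derive.
rewrite /Rintegral (@continuous_FTC2 R G F a b ab)//.
- exact: continuous_subspaceT.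
- split.
  + move=> x; rewrite in_itv /= => /andP[ax xb].
    by have := dF x; rewrite !ltW// => /(_ isT) dFx; exact: ex_derive.
  + by apply: cvg_at_right_filter; apply: cF; rewrite lexx ltW.
  + by apply: cvg_at_left_filter; apply: cF; rewrite lexx ltW.
- move=> x; rewrite in_itv /= => /andP[ax xb]; rewrite derive1E.
  by have := dF x; rewrite !ltW// => /(_ isT) dFx; exact: derive_val.
Qed.

Lemma is_derive_shift (F : R -> R) (h x d : R) :
  is_derive (x + h) 1 F d -> is_derive x 1 (fun t => F (t + h)) d.
Proof.
move=> dF; rewrite -[d]mulr1.
apply: (@is_derive1_comp R F (fun t => t + h)).
by rewrite -[X in is_derive _ _ _ X](addr0 1); exact: is_deriveD.
Qed.

(** With a primitive F, the integral shifted by x is F (x + 2 pi) - F x, whose derivative in x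
    vanishes by periodicity. *)
Lemma intT_shift (G : R -> R) (h : R) : continuous G ->
  (forall t, G (t + 2 * pi) = G t) -> intT (fun t => G (t + h)) = intT G.
Proof.
have cshift (H : R -> R) (k : R) : continuous H -> continuous (fun t => H (t + k)).
  move=> cH t; apply: (@continuous_comp _ _ _ (fun t => t + k) H); last exact: cH.
  by exact: (cvgD cvg_id (cvg_cst _)).
have pos (H : R -> R) (k : R) : 0 <= k -> continuous H ->
    (forall t, H (t + 2 * pi) = H t) -> intT (fun t => H (t + k)) = intT H.
  (* The base point - 1 makes F differentiable with derivative H on both sides of every x >= 0,
     including 0. *)
  move=> k0 cH pH; have [F dF] := @antiderivative H (- 1) cH.
  have dF0 (x : R) : 0 <= x -> is_derive x 1 F (H x).
    by move=> x0; apply: dF; apply: lt_le_trans x0; rewrite ltrN10.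
  have intF (x : R) : 0 <= x -> intT (fun t => H (t + x)) = F (x + 2 * pi) - F x.
    move=> x0; transitivity (F (2 * pi + x) - F (0 + x)); last first.
      by rewrite add0r [2 * pi + x]addrC.
    apply: (@FTC2 _ (fun t => F (t + x)) _ _ twopi_gt0); first exact: cshift.
    by move=> y /andP[y0 _]; apply: is_derive_shift; apply: dF0; rewrite addr_ge0.
  have -> : intT H = intT (fun t => H (t + 0)).
    by congr intT; apply/funext => t; rewrite addr0.
  rewrite !intF//; pose D x := F (x + 2 * pi) - F x.
  have dD (x : R) : 0 <= x -> is_derive x 1 D 0.
    move=> x0; rewrite -[0](subrr (H x)) -{1}pH.
    apply: is_deriveB; last exact: dF0.
    by apply: is_derive_shift; apply: dF0; rewrite addr_ge0// ltW// twopi_gt0.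
  have [||c _] := @MVT_segment R D (fun=> 0) 0 k k0.
  - by move=> x; rewrite in_itv /= => /andP[/ltW x0 _]; exact: dD.
  - apply: derivable_within_continuous => x; rewrite in_itv /= => /andP[x0 _].
    by have := dD _ x0 => ?; exact: ex_derive.
  - by rewrite mul0r => /eqP; rewrite subr_eq0 => /eqP.
move=> cG pG; have [h0|h0] := leP 0 h; first exact: pos.
(* A negative shift is undone by the positive shift [- h] of the shifted function. *)
rewrite -(pos (fun t => G (t + h)) (- h)); last 3 first.
- by rewrite oppr_ge0 ltW.
- exact: cshift.
- by move=> t; rewrite addrAC pG.
by congr intT; apply/funext => t; rewrite subrK.
Qed.

End RealLine.

(** * Continuous functions on the torus *)

Section TorusFunctions.
Context {R : realType}.

Definition near_coord {n} (d : R) (x y : 'rV[R]_n) := forall i, `|x 0 i - y 0 i| <= d.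

Definition period {n} (k : 'rV[int]_n) : 'rV[R]_n :=
  \row_i ((k 0 i)%:~R * (2 * pi)).

Lemma period_coord {T : Type} {n} (u : 'rV[R]_n -> T) :
  (forall x i, u (x + (2 * pi) *: delta_mx 0 i) = u x) ->
  forall k x, u (x + period k) = u x.
Proof.
move=> pu k x.
have pnat i (m : nat) y : u (y + (m%:R * (2 * pi)) *: delta_mx 0 i) = u y.
  elim: m y => [|m IH] y; first by rewrite mul0r scale0r addr0.
  by rewrite -natr1 mulrDl scalerDl mul1r addrA pu.
have pint i (m : int) y : u (y + (m%:~R * (2 * pi)) *: delta_mx 0 i) = u y.
  case: m => m; first exact: pnat.
  rewrite NegzE mulrNz mulNr scaleNr -[LHS](pnat i m.+1).
  by rewrite subrK.
rewrite [period k]row_sum_delta.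
elim: (index_enum _) x => [|i s IH] x; first by rewrite big_nil addr0.
by rewrite big_cons addrA IH mxE pint.
Qed.

(** Centring at 0 serves twice: for the compact box behind uniform continuity, and in Korovkin's
    argument, where cos decreases with the modulus of a coordinate up to pi. *)
Lemma period_centred {n} (x : 'rV[R]_n) :
  exists k, forall i, `|(x + period k) 0 i| <= pi.
Proof.
exists (\row_i - Num.floor ((x 0 i + pi) / (2 * pi))) => i.
rewrite !mxE mulrNz mulNr.
set q := _ / _; have /andP[q1 q2] := mem_rg1_floor q.
have qE : x 0 i = q * (2 * pi) - pi by rewrite divfK ?gt_eqF ?twopi_gt0// addrK.
rewrite {1}qE ler_norml; have p0 := @pi_gt0 R.
apply/andP; split; [have : 0 <= (q - (Num.floor q)%:~R) * (2 * pi)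
  |have : 0 <= ((Num.floor q)%:~R + 1 - q) * (2 * pi)].
- by rewrite mulr_ge0 ?subr_ge0// mulr_ge0// ltW.
- by lra.
- by rewrite mulr_ge0 ?subr_ge0// ?ltW// mulr_gt0.
- by lra.
Qed.

Lemma nbhs_coord {n} (x : 'rV[R]_n) (A : set 'rV[R]_n) :
  nbhs x A <-> exists2 d : R, 0 < d & (forall y, near_coord d x y -> A y).
Proof.
split=> [/nbhs_ballP[d /= d0 dA]|[d d0 dA]].
  exists (d / 2); first by rewrite divr_gt0.
  move=> y xy; apply: dA; split => // i j; rewrite ord1.
  apply: le_lt_trans (xy j) _; rewrite ltr_pdivrMr// mulr_natr.
  by rewrite mulr2n ltrDl.
apply/nbhs_ballP; exists d => //= y [_ xy]; apply: dA => i.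
by apply/ltW; exact: xy.
Qed.

Lemma continuous_coordP {n} (u : 'rV[R]_n -> R) : continuous u <->
  forall x (e : R), 0 < e ->
    exists2 d : R, 0 < d & (forall y, near_coord d x y -> `|u x - u y| <= e).
Proof.
split=> [cu x e e0|cu x].
  have : nbhs x [set y | `|u x - u y| <= e].
    exact: (@cvgrPdist_le R R^o _ (nbhs x) _ u (u x)).1 (cu x) e e0.
  by move/nbhs_coord.
apply: (@cvgrPdist_le R R^o _ (nbhs x) _ u (u x)).2 => e e0.
have : nbhs x [set y | `|u x - u y| <= e] by apply/nbhs_coord; exact: cu.
by [].
Qed.

Definition torus_cont {n} (u : 'rV[R]_n -> R) :=
  continuous u /\ (forall x i, u (x + (2 * pi) *: delta_mx 0 i) = u x).

Definition box {n} : set 'rV[R]_n := [set v | forall i, `[- pi, pi]%classic (v 0 i)].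

Lemma compact_box {n} : compact (@box n).
Proof.
exact: (@rV_compact R n (fun=> `[- pi, pi]%classic) (fun=> @segment_compact R _ _)).
Qed.

Lemma box_period {n} (x : 'rV[R]_n) : exists k, box (x + period k).
Proof.
have [k xk] := period_centred x; exists k => i /=.
by rewrite in_itv /= -ler_norml.
Qed.

(** Heine-Cantor on the box, as a near-covering with the radius tending to 0. The covering property
    quantifies over every y, so after translating x and y by the same period only x has to lie in
    the box. *)
Lemma torus_unif_cont {n} (u : 'rV[R]_n -> R) : torus_cont u ->
  forall e : R, 0 < e ->
  exists2 d : R, 0 < d & (forall x y, near_coord d x y -> `|u x - u y| <= e).
Proof.
move=> [/continuous_coordP cu pu] e e0.
have /compact_near_coveringP := @compact_box n.
move=> /(_ R 0^'+ (fun d x => forall y, near_coord d x y -> `|u x - u y| <= e) _).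
case=> [x _|d /= d0 dP].
  have [d d0 dx] := cu x (e / 2) (divr_gt0 e0 (ltr0Sn _ _)).
  exists ([set y | near_coord (d / 2) x y], [set t | t < d / 2]) => /=.
    split; first by apply/nbhs_coord; exists (d / 2) => //; rewrite divr_gt0.
    by apply: nbhs_right_lt; rewrite divr_gt0.
  move=> [y t] /= [xy td] z yz.
  have -> : u y - u z = (u x - u z) - (u x - u y) by lra.
  apply: le_trans (ler_normB _ _) _; rewrite [leRHS]splitr lerD//; apply: dx => i.
    have -> : x 0 i - z 0 i = (x 0 i - y 0 i) + (y 0 i - z 0 i) by lra.
    apply: le_trans (ler_normD _ _) _; rewrite [leRHS]splitr lerD//.
    by apply: le_trans (yz i) _; exact: ltW.
  by apply: le_trans (xy i) _; rewrite ler_pdivrMr// ler_peMr ?ltW// ltr1n.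
exists (d / 2); first by rewrite divr_gt0.
move=> x y xy; have [k xk] := box_period x.
rewrite -(period_coord pu k x) -(period_coord pu k y).
have := dP (d / 2); apply => //=.
- by rewrite sub0r normrN gtr0_norm ?divr_gt0// ltr_pdivrMr// ltr_pMr// ltr1n.
- by rewrite divr_gt0.
- by move=> i; rewrite !mxE opprD addrACA subrr addr0.
Qed.

(** The same covering argument, with the bound M tending to infinity in place of the radius. *)
Lemma torus_bounded {n} (u : 'rV[R]_n -> R) : torus_cont u ->
  exists M : R, forall x, `|u x| <= M.
Proof.
move=> [/continuous_coordP cu pu].
have /compact_near_coveringP := @compact_box n.
move=> /(_ R +oo (fun M x => `|u x| <= M) _).
case=> [x _|M [_ MP]].
  have [d d0 dx] := cu x 1 ltr01.
  exists ([set y | near_coord d x y], [set t | `|u x| + 1 <= t]) => /=.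
    split; first by apply/nbhs_coord; exists d.
    by apply: nbhs_pinfty_ge; exact: num_real.
  move=> [y t] /= [xy tx]; apply: le_trans tx.
  have -> : u y = u x - (u x - u y) by lra.
  by apply: le_trans (ler_normB _ _) _; rewrite lerD2l dx.
exists (M + 1) => x; have [k xk] := box_period x.
by rewrite -(period_coord pu k x); apply: MP xk; rewrite ltrDl.
Qed.

Lemma torus_contD {n} (u v : 'rV[R]_n -> R) : torus_cont u -> torus_cont v ->
  torus_cont (fun x => u x + v x).
Proof.
move=> [cu pu] [cv pv]; split=> [x|x i]; last by rewrite pu pv.
exact: (cvgD (cu x) (cv x)).
Qed.

Lemma torus_contM {n} (u v : 'rV[R]_n -> R) : torus_cont u -> torus_cont v ->
  torus_cont (fun x => u x * v x).
Proof.
move=> [cu pu] [cv pv]; split=> [x|x i]; last by rewrite pu pv.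
exact: (cvgM (cu x) (cv x)).
Qed.

Lemma torus_cont_cst {n} (c : R) : torus_cont (fun _ : 'rV[R]_n => c).
Proof. by split=> [x|//]; exact: (@cvg_cst _ _ _ (nbhs x)). Qed.

Lemma torus_contZ {n} (c : R) (u : 'rV[R]_n -> R) : torus_cont u ->
  torus_cont (fun x => c * u x).
Proof. exact: (torus_contM (torus_cont_cst c)). Qed.

Lemma torus_contN {n} (u : 'rV[R]_n -> R) : torus_cont u ->
  torus_cont (fun x => - u x).
Proof.
move=> [cu pu]; split=> [x|x i]; last by rewrite pu.
exact: (cvgN (cu x)).
Qed.

Lemma torus_contB {n} (u v : 'rV[R]_n -> R) : torus_cont u -> torus_cont v ->
  torus_cont (fun x => u x - v x).
Proof. by move=> cu /torus_contN; exact: torus_contD. Qed.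

Lemma torus_cont_shift {n} (u : 'rV[R]_n -> R) (a : 'rV[R]_n) : torus_cont u ->
  torus_cont (fun x => u (x + a)).
Proof.
move=> [/continuous_coordP cu pu]; split=> [|x i]; last by rewrite addrAC pu.
apply/continuous_coordP => x e e0; have [d d0 dx] := cu (x + a) e e0.
exists d => // y xy; apply: dx => i.
by rewrite !mxE opprD addrACA subrr addr0.
Qed.

Lemma torus_cont_unif_lim {n} (u : 'rV[R]_n -> R) :
  (forall e : R, 0 < e ->
    exists2 v, torus_cont v & forall x, `|u x - v x| <= e) ->
  torus_cont u.
Proof.
move=> lu; split.
  apply/continuous_coordP => x e e0.
  have e3 : 0 < e / 3 by rewrite divr_gt0.
  have [v [/continuous_coordP cv _] uv] := lu _ e3.
  have [d d0 dv] := cv x _ e3.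
  exists d => // y xy.
  have -> : u x - u y = (u x - v x) + (v x - v y) + - (u y - v y) by lra.
  apply: le_trans (ler_normD _ _) _; rewrite normrN.
  have : `|u x - v x + (v x - v y)| <= e / 3 + e / 3.
    by apply: le_trans (ler_normD _ _) _; rewrite lerD// dv.
  by have := uv y; lra.
move=> x i; apply/eqP; rewrite -subr_eq0 -normr_le0; apply/ler_addgt0Pl => e e0.
have e2 : 0 < e / 2 by rewrite divr_gt0.
have [v [_ pv] uv] := lu _ e2.
have -> : u (x + (2 * pi) *: delta_mx 0 i) - u x
   = (u (x + (2 * pi) *: delta_mx 0 i) - v (x + (2 * pi) *: delta_mx 0 i))
     - (u x - v x) by rewrite pv; lra.
by apply: le_trans (ler_normB _ _) _; rewrite addr0 [leRHS]splitr lerD.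
Qed.

Definition slice {n} (u : 'rV[R]_n.+1 -> R) (t : R) : 'rV[R]_n -> R :=
  fun y => u (row_mx (const_mx t : 'rV_1) y).

Lemma add_delta_coord {n} (x : 'rV[R]_n) (h : R) (i j : 'I_n) :
  (x + h *: delta_mx 0 i) 0 j = x 0 j + h * (j == i)%:R.
Proof. by rewrite !mxE eqxx. Qed.

Lemma row_mx_shift0 {n} (t h : R) (y : 'rV[R]_n) :
  row_mx (const_mx (t + h) : 'rV_1) y =
  row_mx (const_mx t : 'rV_1) y + h *: delta_mx 0 (lshift n ord0).
Proof.
apply/rowP => i; rewrite add_delta_coord.
case: (split_ordP i) => j ->.
  by rewrite !row_mxEl !mxE ord1 eqxx mulr1.
by rewrite !row_mxEr eq_rlshift mulr0 addr0.
Qed.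

Lemma row_mx_shiftS {n} (t h : R) (y : 'rV[R]_n) (j : 'I_n) :
  row_mx (const_mx t : 'rV_1) (y + h *: delta_mx 0 j) =
  row_mx (const_mx t : 'rV_1) y + h *: delta_mx 0 (rshift 1 j).
Proof.
apply/rowP => i; rewrite add_delta_coord.
case: (split_ordP i) => k ->.
  by rewrite !row_mxEl eq_lrshift mulr0 addr0.
by rewrite !row_mxEr add_delta_coord eq_rshift.
Qed.

Lemma near_coord_row_mx {n} (d s t : R) (x y : 'rV[R]_n) :
  `|s - t| <= d -> near_coord d x y ->
  near_coord d (row_mx (const_mx s : 'rV_1) x) (row_mx (const_mx t : 'rV_1) y).
Proof.
move=> st xy i; case: (split_ordP i) => k ->; first by rewrite !row_mxEl !mxE.
by rewrite !row_mxEr.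
Qed.

Lemma torus_cont_slice {n} (u : 'rV[R]_n.+1 -> R) (t : R) :
  torus_cont u -> torus_cont (slice u t).
Proof.
move=> [/continuous_coordP cu pu]; split; last first.
  by move=> x i; rewrite /slice row_mx_shiftS pu.
apply/continuous_coordP => x e e0; have [d d0 dx] := cu (row_mx (const_mx t : 'rV_1) x) e e0.
exists d => // y xy; apply: dx; apply: near_coord_row_mx => //.
by rewrite subrr normr0 ltW.
Qed.

End TorusFunctions.

(** * Integration on the torus *)

Section TorusIntegral.
Context {R : realType}.

Lemma torus_Rint_cst n (c : R) :
  torus_Rint (fun _ : 'rV[R]_n => c) = (2 * pi) ^+ n * c.
Proof.
elim: n => [|n IH]; first by rewrite expr0 mul1r.
have -> : torus_Rint (fun _ : 'rV[R]_n.+1 => c) =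
          intT (fun=> torus_Rint (fun _ : 'rV[R]_n => c)) by [].
by rewrite intT_cst IH mulrA -exprS.
Qed.

Lemma torus_RintS n (u : 'rV[R]_n.+1 -> R) :
  torus_Rint u = intT (fun t => torus_Rint (slice u t)).
Proof. by []. Qed.

(** Linearity and monotonicity are bundled because the induction on n needs both at once: together
    they make the inner integral continuous in t, which is what allows the outer integral to be
    split and compared. *)
Definition positive_linear n (I : ('rV[R]_n -> R) -> R) :=
  forall u v, torus_cont u -> torus_cont v ->
    (forall c, I (fun x => c * u x + v x) = c * I u + I v) /\
    ((forall x, u x <= v x) -> I u <= I v).

Lemma positive_linear_dist n (I : ('rV[R]_n -> R) -> R) (u v : 'rV[R]_n -> R) (e : R) :
  positive_linear I -> (forall c, I (fun=> c) = (2 * pi) ^+ n * c) ->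
  torus_cont u -> torus_cont v -> (forall x, `|u x - v x| <= e) ->
  `|I u - I v| <= (2 * pi) ^+ n * e.
Proof.
move=> plI cstI; have H (f g : 'rV[R]_n -> R) : torus_cont f -> torus_cont g ->
    (forall x, `|f x - g x| <= e) -> I f - I g <= (2 * pi) ^+ n * e.
  move=> cf cg fg; rewrite lerBlDl -cstI -[I g]mul1r.
  have ce := @torus_cont_cst R n e.
  rewrite -(plI g (fun=> e) cg ce).1; apply: (plI _ _ _ _).2 => //.
    by apply: torus_contD => //; exact: torus_contZ.
  by move=> x; have := fg x; rewrite ler_norml mul1r => /andP[_]; lra.
move=> cu cv uv; rewrite ler_norml lerNl opprB !H// => x.
by rewrite distrC.
Qed.

(** Uniform continuity provides one radius in t valid for all points y of the slice. *)
Lemma slice_integral_continuous n (u : 'rV[R]_n.+1 -> R) :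
  positive_linear (@torus_Rint R n) -> torus_cont u ->
  continuous (fun t => torus_Rint (slice u t)).
Proof.
move=> pl cu t; apply: (@cvgrPdist_le R R^o _ (nbhs t) _ _ _).2 => e e0.
have p0 : 0 < (2 * pi) ^+ n :> R by rewrite exprn_gt0// twopi_gt0.
have [d d0 du] := torus_unif_cont cu (divr_gt0 e0 p0).
have : nbhs t [set s | `|t - s| <= d].
  by apply/nbhs_ballP; exists d => //= s /= /ltW.
apply: filterS => s /= ts.
have -> : e = (2 * pi) ^+ n * (e / (2 * pi) ^+ n) by rewrite mulrC divfK// gt_eqF.
apply: positive_linear_dist => //.
- exact: torus_Rint_cst.
- exact: torus_cont_slice.
- exact: torus_cont_slice.
- by move=> x; apply: du; apply: near_coord_row_mx => // i; rewrite subrr normr0 ltW.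
Qed.

Lemma torus_Rint_positive_linear n : positive_linear (@torus_Rint R n).
Proof.
elim: n => [|n IH] u v cu cv; first by split => [c|uv] //=; exact: uv.
have Gu := slice_integral_continuous IH cu.
have Gv := slice_integral_continuous IH cv.
split => [c|uv].
  rewrite !torus_RintS -intT_linear//; congr intT; apply/funext => t.
  by rewrite -(IH _ _ (torus_cont_slice t cu) (torus_cont_slice t cv)).1.
rewrite !torus_RintS; apply: ler_intT => // t.
apply: (IH _ _ (torus_cont_slice t cu) (torus_cont_slice t cv)).2 => y.
exact: uv.
Qed.

(** A shift of the first coordinate acts on the outer integral and is [intT_shift]; any other shift
    acts inside the slices and is the induction hypothesis. *)
Lemma torus_Rint_shift n (u : 'rV[R]_n -> R) (j : 'I_n) (h : R) : torus_cont u ->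
  torus_Rint (fun x => u (x + h *: delta_mx 0 j)) = torus_Rint u.
Proof.
elim: n u j => [|n IH] u j; first by case: j.
move=> cu; have cG := slice_integral_continuous (@torus_Rint_positive_linear n) cu.
rewrite !torus_RintS; case: (@split_ordP 1 n j) => k ->.
  rewrite -(@intT_shift R (fun t => torus_Rint (slice u t)) h)//.
    congr intT; apply/funext => t; congr torus_Rint; apply/funext => y.
    by rewrite /slice row_mx_shift0 ord1.
  move=> t; congr torus_Rint; apply/funext => y.
  by rewrite /slice row_mx_shift0 cu.2.
congr intT; apply/funext => t; rewrite -(IH (slice u t) k); last exact: torus_cont_slice.
by congr torus_Rint; apply/funext => y; rewrite /slice row_mx_shiftS.
Qed.

Definition torus_contC {n} (f : 'rV[R]_n -> R[i]) :=
  torus_cont (fun x => Re (f x)) /\ torus_cont (fun x => Im (f x)).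

Lemma continuous_normcP {n} (f : 'rV[R]_n -> R[i]^o) : continuous f <->
  forall x (e : R), 0 < e ->
    exists2 d : R, 0 < d & (forall y, near_coord d x y -> normc (f x - f y) <= e).
Proof.
split=> [cf x e e0|cf x].
  have : nbhs x [set y | normc (f x - f y) <= e].
    exact: (@cvgcP R _ (nbhs x) _ f (f x)).1 (cf x) e e0.
  by move/nbhs_coord.
apply: (@cvgcP R _ (nbhs x) _ f (f x)).2 => e e0.
by apply/nbhs_coord; exact: cf.
Qed.

Lemma torus_contCP {n} (f : 'rV[R]_n -> R[i]) : torus_C 0 f <-> torus_contC f.
Proof.
split=> [[pf [/continuous_normcP cf _]]|[[/continuous_coordP c1 p1] [/continuous_coordP c2 p2]]].
  split; split; try by move=> x i; rewrite pf.
    apply/continuous_coordP => x e e0; have [d d0 dx] := cf x e e0.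
    exists d => // y xy; apply: le_trans (dx y xy).
    by apply: le_trans (ler_Re_normc _); case: (f x) => ? ?; case: (f y).
  apply/continuous_coordP => x e e0; have [d d0 dx] := cf x e e0.
  exists d => // y xy; apply: le_trans (dx y xy).
  by apply: le_trans (ler_Im_normc _); case: (f x) => ? ?; case: (f y).
split; first by move=> x i; apply: complexP; rewrite ?p1 ?p2.
split=> //; apply/continuous_normcP => x e e0.
have e2 : 0 < e / 2 by rewrite divr_gt0.
have [d1 d10 dx1] := c1 x _ e2; have [d2 d20 dx2] := c2 x _ e2.
exists (Num.min d1 d2) => [|y xy]; first by rewrite lt_min d10.
apply: le_trans (normc_le_ReIm _) _; rewrite [leRHS]splitr lerD//.
  have := dx1 y; case: (f x) => ? ?; case: (f y) => ? ? /=; apply => i.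
  by apply: le_trans (xy i) _; rewrite ge_min lexx.
have := dx2 y; case: (f x) => ? ?; case: (f y) => ? ? /=; apply => i.
by apply: le_trans (xy i) _; rewrite ge_min lexx orbT.
Qed.

Lemma torus_contC_cst n (c : R[i]) : torus_contC (fun _ : 'rV[R]_n => c).
Proof. by split; exact: torus_cont_cst. Qed.

Lemma torus_contCD n (f g : 'rV[R]_n -> R[i]) :
  torus_contC f -> torus_contC g -> torus_contC (fun x => f x + g x).
Proof.
move=> [f1 f2] [g1 g2]; split.
  by rewrite (_ : (fun _ => _) = (fun x => Re (f x) + Re (g x)));
    [exact: torus_contD|apply/funext => x; rewrite cReD].
by rewrite (_ : (fun _ => _) = (fun x => Im (f x) + Im (g x)));
  [exact: torus_contD|apply/funext => x; rewrite cImD].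
Qed.

Lemma torus_contCM n (f g : 'rV[R]_n -> R[i]) :
  torus_contC f -> torus_contC g -> torus_contC (fun x => f x * g x).
Proof.
move=> [f1 f2] [g1 g2]; split.
  rewrite (_ : (fun _ => _) = (fun x => Re (f x) * Re (g x) - Im (f x) * Im (g x))).
    by apply: torus_contB; exact: torus_contM.
  by apply/funext => x; rewrite cReM.
rewrite (_ : (fun _ => _) = (fun x => Re (f x) * Im (g x) + Im (f x) * Re (g x))).
  by apply: torus_contD; exact: torus_contM.
by apply/funext => x; rewrite cImM.
Qed.

Lemma torus_contCZ n (c : R[i]) (f : 'rV[R]_n -> R[i]) :
  torus_contC f -> torus_contC (fun x => c * f x).
Proof. exact: (torus_contCM (@torus_contC_cst n c)). Qed.

Lemma torus_contCB n (f g : 'rV[R]_n -> R[i]) :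
  torus_contC f -> torus_contC g -> torus_contC (fun x => f x - g x).
Proof.
move=> cf cg; rewrite (_ : (fun _ => _) = (fun x => f x + (-1) * g x)).
  by apply: torus_contCD => //; exact: torus_contCZ.
by apply/funext => x; rewrite mulN1r.
Qed.

Lemma torus_contC_sum n (I : Type) (s : seq I) (F : I -> 'rV[R]_n -> R[i]) :
  (forall j, torus_contC (F j)) -> torus_contC (fun x => \sum_(j <- s) F j x).
Proof.
move=> cF; elim: s => [|j s IH].
  rewrite (_ : (fun _ => _) = (fun=> 0)); first exact: torus_contC_cst.
  by apply/funext => x; rewrite big_nil.
rewrite (_ : (fun _ => _) = (fun x => F j x + \sum_(j <- s) F j x)).
  exact: torus_contCD.
by apply/funext => x; rewrite big_cons.
Qed.

Lemma torus_contC_shift n (f : 'rV[R]_n -> R[i]) (a : 'rV[R]_n) :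
  torus_contC f -> torus_contC (fun x => f (x + a)).
Proof. by move=> [f1 f2]; split; [move: f1|move: f2] => /torus_cont_shift; exact. Qed.

Lemma torus_contC_bounded n (f : 'rV[R]_n -> R[i]) : torus_contC f ->
  exists M : R, forall x, normc (f x) <= M.
Proof.
move=> [/torus_bounded[M1 f1] /torus_bounded[M2 f2]]; exists (M1 + M2) => x.
by apply: le_trans (normc_le_ReIm _) _; rewrite lerD.
Qed.

Lemma torus_contC_unif_cont n (f : 'rV[R]_n -> R[i]) : torus_contC f ->
  forall e : R, 0 < e ->
  exists2 d : R, 0 < d & (forall x y, near_coord d x y -> normc (f x - f y) <= e).
Proof.
move=> [/torus_unif_cont f1 /torus_unif_cont f2] e e0.
have e2 : 0 < e / 2 by rewrite divr_gt0.
have [d1 d10 dx1] := f1 _ e2; have [d2 d20 dx2] := f2 _ e2.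
exists (Num.min d1 d2) => [|x y xy]; first by rewrite lt_min d10.
apply: le_trans (normc_le_ReIm _) _; rewrite [leRHS]splitr lerD//.
  have := dx1 x y; case: (f x) => ? ?; case: (f y) => ? ? /=; apply => i.
  by apply: le_trans (xy i) _; rewrite ge_min lexx.
have := dx2 x y; case: (f x) => ? ?; case: (f y) => ? ? /=; apply => i.
by apply: le_trans (xy i) _; rewrite ge_min lexx orbT.
Qed.

Lemma torus_contC_unif_lim n (f : 'rV[R]_n -> R[i]) :
  (forall e : R, 0 < e ->
    exists2 g, torus_contC g & forall x, normc (f x - g x) <= e) ->
  torus_contC f.
Proof.
move=> lf; split; apply: torus_cont_unif_lim => e /lf[g [g1 g2] fg].
  exists (fun x => Re (g x)) => // x; apply: le_trans (fg x).
  by apply: le_trans (ler_Re_normc _); case: (f x) => ? ?; case: (g x).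
exists (fun x => Im (g x)) => // x; apply: le_trans (fg x).
by apply: le_trans (ler_Im_normc _); case: (f x) => ? ?; case: (g x).
Qed.

Lemma torus_RintD n (u v : 'rV[R]_n -> R) : torus_cont u -> torus_cont v ->
  torus_Rint (fun x => u x + v x) = torus_Rint u + torus_Rint v.
Proof.
move=> cu cv; rewrite -[torus_Rint u]mul1r.
rewrite -(torus_Rint_positive_linear cu cv).1.
by congr torus_Rint; apply/funext => x; rewrite mul1r.
Qed.

Lemma torus_RintZ n (c : R) (u : 'rV[R]_n -> R) : torus_cont u ->
  torus_Rint (fun x => c * u x) = c * torus_Rint u.
Proof.
move=> cu; have c0 := @torus_cont_cst R n 0.
transitivity (c * torus_Rint u + torus_Rint (fun _ : 'rV[R]_n => 0)).
  rewrite -(torus_Rint_positive_linear cu c0).1.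
  by congr torus_Rint; apply/funext => x; rewrite addr0.
by rewrite torus_Rint_cst mulr0 addr0.
Qed.

Lemma ler_torus_Rint n (u v : 'rV[R]_n -> R) : torus_cont u -> torus_cont v ->
  (forall x, u x <= v x) -> torus_Rint u <= torus_Rint v.
Proof. by move=> cu cv; exact: (torus_Rint_positive_linear cu cv).2. Qed.

Lemma torus_cont_sum n (I : Type) (s : seq I) (F : I -> 'rV[R]_n -> R) :
  (forall j, torus_cont (F j)) -> torus_cont (fun x => \sum_(j <- s) F j x).
Proof.
move=> cF; elim: s => [|j s IH].
  rewrite (_ : (fun _ => _) = fun=> 0); first exact: torus_cont_cst.
  by apply/funext => x; rewrite big_nil.
rewrite (_ : (fun _ => _) = (fun x => F j x + \sum_(j <- s) F j x)).
  exact: torus_contD.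
by apply/funext => x; rewrite big_cons.
Qed.

Lemma torus_Rint_sum n (I : Type) (s : seq I) (F : I -> 'rV[R]_n -> R) :
  (forall j, torus_cont (F j)) ->
  torus_Rint (fun x => \sum_(j <- s) F j x) = \sum_(j <- s) torus_Rint (F j).
Proof.
move=> cF; elim: s => [|j s IH].
  rewrite big_nil -[RHS](mulr0 ((2 * pi) ^+ n)) -torus_Rint_cst.
  by congr torus_Rint; apply/funext => x; rewrite big_nil.
rewrite big_cons -IH -torus_RintD//; last exact: torus_cont_sum.
by congr torus_Rint; apply/funext => x; rewrite big_cons.
Qed.

Lemma torus_intD n (f g : 'rV[R]_n -> R[i]) : torus_contC f -> torus_contC g ->
  torus_int (fun x => f x + g x) = torus_int f + torus_int g.
Proof.
move=> [f1 f2] [g1 g2]; apply: complexP => /=; rewrite -torus_RintD//;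
  by congr torus_Rint; apply/funext => x /=; rewrite ?cReD ?cImD.
Qed.

Lemma torus_intZ n (c : R[i]) (f : 'rV[R]_n -> R[i]) : torus_contC f ->
  torus_int (fun x => c * f x) = c * torus_int f.
Proof.
move=> [f1 f2]; apply: complexP.
  rewrite cReM /= -!torus_RintZ// -mulN1r -torus_RintZ; last exact: torus_contZ.
  rewrite -torus_RintD; [|exact: torus_contZ|by do 2!apply: torus_contZ].
  by congr torus_Rint; apply/funext => x /=; rewrite cReM mulN1r.
rewrite cImM /= -!torus_RintZ//.
rewrite -torus_RintD; [|exact: torus_contZ|exact: torus_contZ].
by congr torus_Rint; apply/funext => x /=; rewrite cImM.
Qed.

Lemma torus_intB n (f g : 'rV[R]_n -> R[i]) : torus_contC f -> torus_contC g ->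
  torus_int (fun x => f x - g x) = torus_int f - torus_int g.
Proof.
move=> cf cg; rewrite -mulN1r -torus_intZ// -torus_intD//; last exact: torus_contCZ.
by congr torus_int; apply/funext => x; rewrite mulN1r.
Qed.

Lemma torus_int_cst n (c : R[i]) :
  torus_int (fun _ : 'rV[R]_n => c) = ((2 * pi) ^+ n)%:C * c.
Proof.
apply: complexP; rewrite ?Re_real_mul ?Im_real_mul /= -torus_Rint_cst;
  by congr torus_Rint.
Qed.

Lemma torus_int_sum n (I : Type) (s : seq I) (F : I -> 'rV[R]_n -> R[i]) :
  (forall j, torus_contC (F j)) ->
  torus_int (fun x => \sum_(j <- s) F j x) = \sum_(j <- s) torus_int (F j).
Proof.
move=> cF; elim: s => [|j s IH].
  rewrite big_nil -[RHS](mulr0 ((2 * pi) ^+ n)%:C) -torus_int_cst.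
  by congr torus_int; apply/funext => x; rewrite big_nil.
rewrite big_cons -IH -torus_intD//; last exact: torus_contC_sum.
by congr torus_int; apply/funext => x; rewrite big_cons.
Qed.

Lemma torus_int_shift n (f : 'rV[R]_n -> R[i]) (j : 'I_n) (h : R) :
  torus_contC f ->
  torus_int (fun x => f (x + h *: delta_mx 0 j)) = torus_int f.
Proof.
move=> [f1 f2]; apply: complexP => /=.
  exact: (torus_Rint_shift j h f1).
exact: (torus_Rint_shift j h f2).
Qed.

(** After rotation by its phase w the integral equals its modulus, so only the real part of w f
    counts, and it is at most G pointwise. *)
Lemma normc_torus_int n (f : 'rV[R]_n -> R[i]) (G : 'rV[R]_n -> R) :
  torus_contC f -> torus_cont G -> (forall x, normc (f x) <= G x) ->
  normc (torus_int f) <= torus_Rint G.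
Proof.
move=> cf cG fG; have [w w1 wI] := normc_phase (torus_int f).
have -> : normc (torus_int f) = Re (torus_int (fun x => w * f x)).
  by rewrite torus_intZ// wI.
apply: ler_torus_Rint => //; first exact: (torus_contCZ w cf).1.
move=> x /=; apply: le_trans (fG x); apply: le_trans (ler_norm _) _.
by apply: le_trans (ler_Re_normc _) _; rewrite normcM w1 mul1r.
Qed.

Lemma normc_torus_int_le n (f : 'rV[R]_n -> R[i]) (M : R) :
  torus_contC f -> (forall x, normc (f x) <= M) ->
  normc (torus_int f) <= (2 * pi) ^+ n * M.
Proof.
by move=> cf fM; rewrite -torus_Rint_cst; apply: normc_torus_int => //;
  exact: torus_cont_cst.
Qed.

End TorusIntegral.

(** * Trigonometric polynomials and the resolvent bound *)

Section DerivativesAtZero.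
Context {R : realType}.

Lemma is_derive_quotient (F : R -> R) (d : R) : is_derive (0 : R) 1 F d ->
  (F h - F 0) / h @[h --> 0^'] --> d.
Proof.
move=> dF; have dF0 : derivable F 0 1 := ex_derive.
rewrite -(derive_val (is_derive := dF)).
suff -> : (fun h : R => (F h - F 0) / h) =
    (fun h : R => h^-1 *: ((F \o shift 0) (h *: (1 : R)) - F 0)) by exact: dF0.
by apply/funext => h /=; rewrite addr0 [_ *: 1]mulr1 mulrC.
Qed.

Lemma is_derive_scale (a x : R) : is_derive x 1 (fun h : R => a * h) a.
Proof.
rewrite -[X in is_derive _ _ _ X]mulr1; apply: (@is_deriveZ R R R (@id R) a x 1 1).
Qed.

Lemma is_derive_sin_scale (a x : R) :
  is_derive x 1 (fun h => sin (a * h)) (cos (a * x) * a).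
Proof.
apply: (@is_derive1_comp R sin (fun h => a * h)); exact: is_derive_scale.
Qed.

Lemma is_derive_cos_scale (a x : R) :
  is_derive x 1 (fun h => cos (a * h)) (- sin (a * x) * a).
Proof.
apply: (@is_derive1_comp R cos (fun h => a * h)); exact: is_derive_scale.
Qed.

Lemma sin_quotient_cvg (a : R) : sin (a * h) / h @[h --> 0^'] --> a.
Proof.
have := is_derive_quotient (is_derive_sin_scale a 0).
rewrite mulr0 cos0 mul1r; under eq_fun do rewrite sin0 subr0.
exact.
Qed.

Lemma cos_quotient_cvg (a : R) : (cos (a * h) - 1) / h @[h --> 0^'] --> (0 : R).
Proof.
have := is_derive_quotient (is_derive_cos_scale a 0).
by rewrite mulr0 sin0 oppr0 mul0r; under eq_fun do rewrite cos0; exact.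
Qed.

(** Since 2 - 2 cos (a h) = 4 sin^2 (a h / 2), the second-order limit is the square of a first-order
    one. *)
Lemma cos_second_quotient_cvg (a : R) :
  (2 - 2 * cos (a * h)) / h ^+ 2 @[h --> 0^'] --> a ^+ 2.
Proof.
have H := @sin_quotient_cvg (a / 2).
rewrite (_ : a ^+ 2 = 2 * (2 * ((a / 2) * (a / 2)))); last by field.
have : 2 * (2 * (sin (a / 2 * h) / h * (sin (a / 2 * h) / h))) @[h --> (0 : R)^']
    --> 2 * (2 * (a / 2 * (a / 2))).
  by apply: cvgM; [exact: cvg_cst|apply: cvgM; [exact: cvg_cst|exact: cvgM]].
apply: cvg_trans; apply: near_eq_cvg; near=> h => /=.
have -> : a * h = (a / 2 * h) *+ 2 by rewrite mulr2n; field.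
rewrite cos_mulr2n cos2sin2.
have h0 : h != 0 by near: h; exact: nbhs_dnbhs_neq.
by rewrite !mulr2n; field.
Unshelve. all: by end_near. Qed.

Lemma cvg_sum0 (I : Type) (s : seq I) (T : Type) (F : set_system T) {FF : Filter F}
    (f : I -> T -> R) : (forall j, f j t @[t --> F] --> (0 : R)) ->
  \sum_(j <- s) f j t @[t --> F] --> (0 : R).
Proof.
move=> f0; elim: s => [|j s IH].
  by under eq_fun do rewrite big_nil; exact: cvg_cst.
under eq_fun do rewrite big_cons.
by have := cvgD (f0 j) IH; rewrite addr0; exact.
Qed.

End DerivativesAtZero.

(** * Characters, Fourier multipliers and the difference Laplacian *)

Section TrigPoly.
Context {R : realType} {n : nat}.
Implicit Types (nu : 'rV[int]_n) (x : 'rV[R]_n) (s : seq (R[i] * 'rV[int]_n)).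

Definition chi nu x : R[i] := expi (freq_dot nu x).

Lemma freq_dotDl nu1 nu2 x : freq_dot (nu1 + nu2) x = freq_dot nu1 x + freq_dot nu2 x.
Proof.
by rewrite /freq_dot -big_split /=; apply: eq_bigr => j _; rewrite mxE intrD mulrDl.
Qed.

Lemma freq_dotDr nu x y : freq_dot nu (x + y) = freq_dot nu x + freq_dot nu y.
Proof.
by rewrite /freq_dot -big_split /=; apply: eq_bigr => j _; rewrite mxE mulrDr.
Qed.

Lemma freq_dotNl nu x : freq_dot (- nu) x = - freq_dot nu x.
Proof.
by rewrite /freq_dot -sumrN; apply: eq_bigr => j _; rewrite mxE mulrNz mulNr.
Qed.

Lemma freq_dotNr nu x : freq_dot nu (- x) = - freq_dot nu x.
Proof. by rewrite /freq_dot -sumrN; apply: eq_bigr => j _; rewrite mxE mulrN. Qed.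

Lemma freq_dot_delta nu (h : R) j : freq_dot nu (h *: delta_mx 0 j) = (nu 0 j)%:~R * h.
Proof.
rewrite /freq_dot (bigD1 j) //= big1 => [|k kj]; rewrite !mxE eqxx.
  by rewrite addr0 eqxx mulr1.
by rewrite (negbTE kj) !mulr0.
Qed.

Lemma chiDl nu1 nu2 x : chi (nu1 + nu2) x = chi nu1 x * chi nu2 x.
Proof. by rewrite /chi freq_dotDl expiD. Qed.

Lemma chiDr nu x y : chi nu (x + y) = chi nu x * chi nu y.
Proof. by rewrite /chi freq_dotDr expiD. Qed.

Lemma chi_conj nu x : (chi nu x)^* = chi (- nu) x.
Proof. by rewrite /chi expi_conj freq_dotNl. Qed.

Lemma chiN nu x : chi (- nu) x = chi nu (- x).
Proof. by rewrite /chi freq_dotNl freq_dotNr. Qed.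

Lemma chi0 x : chi 0 x = 1.
Proof. by rewrite /chi /freq_dot big1 ?expi0// => j _; rewrite mxE mul0r. Qed.

Lemma normc_chi nu x : normc (chi nu x) = 1.
Proof. exact: normc_expi. Qed.

Lemma chi_shift nu x h j : chi nu (x + h *: delta_mx 0 j) = chi nu x * expi ((nu 0 j)%:~R * h).
Proof. by rewrite /chi freq_dotDr freq_dot_delta expiD. Qed.

Lemma near_coord_freq_dot nu (d : R) x y : near_coord d x y ->
  `|freq_dot nu x - freq_dot nu y| <= (\sum_j `|(nu 0 j)%:~R|) * d.
Proof.
move=> xy; rewrite /freq_dot -sumrB mulr_suml.
apply: le_trans (ler_norm_sum _ _ _) _; apply: ler_sum => j _.
by rewrite -mulrBr normrM ler_wpM2l.
Qed.

Lemma freq_dot_continuous nu : continuous (@freq_dot R n nu).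
Proof.
apply/continuous_coordP => x e e0.
have S0 : 0 <= \sum_j `|(nu 0 j)%:~R| :> R by apply: sumr_ge0.
exists (e / (1 + \sum_j `|(nu 0 j)%:~R|)); first by rewrite divr_gt0// ltr_pwDl.
move=> y /(near_coord_freq_dot nu) /le_trans; apply.
rewrite mulrCA; apply: ler_piMr; first exact: ltW.
by rewrite ler_pdivrMr ?ltr_pwDl// mul1r lerDr.
Qed.

Lemma torus_contC_chi nu : torus_contC (chi nu).
Proof.
have per x i : chi nu (x + (2 * pi) *: delta_mx 0 i) = chi nu x.
  by rewrite chi_shift -[expi _]mul1r -expi0 -expiD expi_mul2pi_int expi0 mulr1.
split; split; try by move=> x i; rewrite per.
  move=> x; exact: (@cvg_comp _ _ _ (freq_dot nu) (@cos R) (nbhs x) _ _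
    (@freq_dot_continuous nu x) (@continuous_cos R (freq_dot nu x))).
move=> x; exact: (@cvg_comp _ _ _ (freq_dot nu) (@sin R) (nbhs x) _ _
  (@freq_dot_continuous nu x) (@continuous_sin R (freq_dot nu x))).
Qed.

(** If nu_j is nonzero, translation by pi / nu_j in coordinate j turns [chi nu] into its opposite,
    so translation invariance forces the integral to vanish. *)
Lemma torus_int_chi nu :
  torus_int (chi nu) = if nu == 0 then ((2 * pi) ^+ n)%:C else 0.
Proof.
have [->|nu0] := eqVneq nu 0.
  by rewrite -[RHS]mulr1 -torus_int_cst; congr torus_int; apply/funext => x; rewrite chi0.
have [j nuj] : exists j, nu 0 j != 0.
  apply/existsP; apply: contra_neqT nu0; rewrite negb_exists => /forallP H.
  by apply/rowP => j; rewrite mxE; apply/eqP; have := H j; rewrite negbK.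
have := torus_int_shift j (pi / (nu 0 j)%:~R) (torus_contC_chi nu).
have -> : (fun x => chi nu (x + (pi / (nu 0 j)%:~R) *: delta_mx 0 j)) =
    (fun x => (-1) * chi nu x).
  apply/funext => x; rewrite chi_shift mulrCA divff ?mulr1 ?intr_eq0//.
  rewrite mulrC /expi cospi sinpi; congr (_ * _).
  by apply: complexP => /=; rewrite ?oppr0.
rewrite torus_intZ ?mulN1r; last exact: torus_contC_chi.
move=> /eqP; rewrite eq_sym -addr_eq0 -mulr2n mulrn_eq0 /=.
by move=> /eqP.
Qed.

(* The Fourier multiplier [m] applied to the trigonometric polynomial given by a
   list of pairs (coefficient, frequency). *)
Definition trig (m : 'rV[int]_n -> R) s x : R[i] :=
  \sum_(p <- s) (m p.2)%:C * p.1 * chi p.2 x.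

Lemma torus_contC_trig m s : torus_contC (trig m s).
Proof.
by apply: torus_contC_sum => p; apply: torus_contCZ; exact: torus_contC_chi.
Qed.

Lemma trig_linear a m1 m2 s x :
  trig (fun nu => a * m1 nu + m2 nu) s x = a%:C * trig m1 s x + trig m2 s x.
Proof.
rewrite /trig mulr_sumr -big_split /=; apply: eq_bigr => p _.
by rewrite rmorphD rmorphM /= !mulrDl !mulrA.
Qed.

Lemma normc_trig m s x : normc (trig m s x) <= \sum_(p <- s) `|m p.2| * normc p.1.
Proof.
apply: le_trans (normc_sum _ _ _) _; apply: ler_sum => p _.
by rewrite !normcM normc_chi normc_real mulr1.
Qed.

(** The eigenvalue of A on [chi nu]. *)
Definition lam nu : R := \sum_j (nu 0 j)%:~R ^+ 2.

Lemma lam_ge0 nu : 0 <= lam nu.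
Proof. by apply: sumr_ge0 => j _; exact: sqr_ge0. Qed.

(** The symbol of the difference Laplacian A_h, the sum over j of (2 q(x) - q(x + h e_j) - q(x - h
    e_j)) / h^2. *)
Definition discrete_symbol (h : R) nu : R :=
  \sum_j (2 - 2 * cos ((nu 0 j)%:~R * h)) / h ^+ 2.

Lemma discrete_symbol_cvg nu : discrete_symbol h nu - lam nu @[h --> 0^'] --> (0 : R).
Proof.
rewrite /discrete_symbol /lam; under eq_fun do rewrite -sumrB.
apply: cvg_sum0 => j; set a : R := (nu 0 j)%:~R.
have := cvgB (@cos_second_quotient_cvg R a) (cvg_cst (a ^+ 2)).
by rewrite subrr; exact.
Qed.

Lemma trig_second_difference (h : R) m s x : h != 0 ->
  trig (fun nu => discrete_symbol h nu * m nu) s x =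
  (h ^- 2)%:C * \sum_j (2 * trig m s x - trig m s (x + h *: delta_mx 0 j)
                       - trig m s (x + (- h) *: delta_mx 0 j)).
Proof.
move=> h0; rewrite mulr_sumr /trig /=.
under eq_bigr => p _ do rewrite /discrete_symbol mulr_suml rmorph_sum !mulr_suml.
rewrite exchange_big /=; apply: eq_bigr => j _.
rewrite !mulr_sumr -!sumrB mulr_sumr; apply: eq_bigr => p _.
rewrite !chi_shift mulrN; set c := (m p.2)%:C * p.1 * chi p.2 x.
have -> : (m p.2)%:C * p.1 * (chi p.2 x * expi ((p.2 0 j)%:~R * h)) =
  c * expi ((p.2 0 j)%:~R * h) by rewrite /c !mulrA.
have -> : (m p.2)%:C * p.1 * (chi p.2 x * expi (- ((p.2 0 j)%:~R * h))) =
  c * expi (- ((p.2 0 j)%:~R * h)) by rewrite /c !mulrA.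
set t := (p.2 0 j)%:~R * h.
have -> : 2 * c - c * expi t - c * expi (- t) = (2 - 2 * cos t)%:C * c.
  rewrite -addrA -opprD -mulrDr.
  have -> : expi t + expi (- t) = (2 * cos t)%:C.
    by rewrite /expi cosN sinN; apply: complexP => /=; ring.
  by rewrite rmorphB rmorph_nat /=; ring.
by rewrite rmorphM rmorphM /= /c; ring.
Qed.

(* With B = sup |q|, the identity
     (mu + 2n/h^2) q = (mu + A) q + (A_h - A) q + h^-2 \sum_j (q(x + h e_j) + q(x - h e_j))
   gives mu B <= M + sup |(A_h - A) q|, and h -> 0. *)
Lemma trig_resolvent_bound (mu M : R) m s : 0 < mu ->
  (forall x, normc (trig (fun nu => (mu + lam nu) * m nu) s x) <= M) ->
  forall x, normc (trig m s x) <= M / mu.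
Proof.
move=> mu0 resM; pose q := trig m s.
pose S := [set normc (q x) | x in setT].
have S0 : S !=set0 by exists (normc (q 0)), 0.
have [B0 qB0] := torus_contC_bounded (torus_contC_trig m s).
have supS : has_sup S by split=> //; exists B0 => _ [x _ <-]; exact: qB0.
pose B := sup S.
have qB x : normc (q x) <= B by apply: sup_upper_bound => //; exists x.
(* [E h] bounds sup |(A_h - A) q|; the list is finite, so convergence for each frequency
   suffices. *)
pose E h := \sum_(p <- s) `|(discrete_symbol h p.2 - lam p.2) * m p.2| * normc p.1.
have E_cvg : E h @[h --> 0^'] --> (0 : R).
  apply: cvg_sum0 => p.
  have H1 : (discrete_symbol h p.2 - lam p.2) * m p.2 @[h --> (0 : R)^'] -->
      0 * m p.2.
    by apply: cvgM; [exact: discrete_symbol_cvg|exact: cvg_cst].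
  have H2 : `|(discrete_symbol h p.2 - lam p.2) * m p.2| @[h --> (0 : R)^'] -->
      `|0 * m p.2| by exact: cvg_norm H1.
  have : `|(discrete_symbol h p.2 - lam p.2) * m p.2| * normc p.1 @[h --> (0 : R)^']
      --> `|0 * m p.2| * normc p.1 by apply: cvgM; [exact: H2|exact: cvg_cst].
  by rewrite mul0r normr0 mul0r; exact.
suff muB : mu * B <= M.
  by move=> x; rewrite ler_pdivlMr// mulrC (le_trans _ muB)// ler_pM2l.
apply/ler_addgt0Pr => e e0.
have [h [h0 Eh]] : exists h, h != 0 /\ E h <= e.
  have /filter_ex[h [h0 Eh]] : \forall h \near (0 : R)^', h != 0 /\ E h <= e.
    near=> h; split; first by near: h; exact: nbhs_dnbhs_neq.
    rewrite -[E h]subr0; apply: le_trans (ler_norm _) _; rewrite distrC.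
    by near: h; apply: (@cvgrPdist_le R R^o _ _ _ _ _).1.
  by exists h.
pose N : R := 2 * n%:R / h ^+ 2.
have N0 : 0 <= N by rewrite divr_ge0 ?sqr_ge0// mulr_ge0.
(* Taking the supremum over x puts [N * B] on both sides, where it cancels, so the growth of [N] as
   h -> 0 is harmless. *)
suff H x : (mu + N) * normc (q x) <= M + e + N * B.
  have : B <= (M + e + N * B) / (mu + N).
    apply: ge_sup => // _ [x _ <-].
    by rewrite ler_pdivlMr ?ltr_pwDl// mulrC.
  by rewrite ler_pdivlMr ?ltr_pwDl// mulrDr [B * mu]mulrC [B * N]mulrC lerD2r.
have -> : (mu + N) * normc (q x) = normc ((mu + N)%:C * q x).
  by rewrite normcM normc_real ger0_norm// addr_ge0// ltW.
have -> : (mu + N)%:C * q x = trig (fun nu => (mu + lam nu) * m nu) s x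
    + trig (fun nu => (discrete_symbol h nu - lam nu) * m nu) s x
    + (h ^- 2)%:C * \sum_j (q (x + h *: delta_mx 0 j) + q (x + (- h) *: delta_mx 0 j)).
  have e1 : trig (fun nu => (mu + lam nu) * m nu) s x
      + trig (fun nu => (discrete_symbol h nu - lam nu) * m nu) s x
      = mu%:C * q x + trig (fun nu => discrete_symbol h nu * m nu) s x.
    rewrite -[X in X + _]mul1r -(trig_linear 1) -trig_linear.
    by congr trig; apply/funext => nu; ring.
  rewrite e1 trig_second_difference//.
  under eq_bigr do rewrite -addrA -opprD.
  rewrite sumrB mulrBr sumr_const card_ord -!/q addrA subrK.
  rewrite rmorphD /= mulrDl; congr (_ + _).
  by rewrite /N !rmorphM /= !rmorph_nat -mulr_natr; ring.
apply: le_trans (normcD _ _) _; apply: lerD.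
  apply: le_trans (normcD _ _) _; apply: lerD => //.
  exact: le_trans (normc_trig _ _ _) Eh.
rewrite normcM normc_real ger0_norm ?invr_ge0 ?sqr_ge0//.
rewrite /N mulrAC [_ / _]mulrC ler_wpM2l ?invr_ge0 ?sqr_ge0//.
apply: le_trans (normc_sum _ _ _) _.
rewrite (_ : 2 * n%:R * B = \sum_(j < n) (B + B)); last first.
  by rewrite sumr_const card_ord -mulr_natr; ring.
apply: ler_sum => j _; apply: le_trans (normcD _ _) _.
exact: lerD.
Unshelve. all: by end_near. Qed.

End TrigPoly.

(** * The moment inequality *)

Section MomentInequality.
Context {R : realType}.
Local Notation mu := (@lebesgue_measure R).

(* Balakrishnan's kernel after the substitution v^b = t, which makes it bounded
   near the origin. *)
Definition balakrishnan (b l v : R) : R := l / (l + v `^ b).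

Lemma balakrishnan_ge0 b l v : 0 <= l -> 0 <= balakrishnan b l v.
Proof. by move=> l0; rewrite divr_ge0// addr_ge0// powR_ge0. Qed.

Lemma powR_right_continuous (b : R) : 0 < b -> v `^ b @[v --> 0^'+] --> (0 `^ b : R).
Proof. by move=> b0; rewrite powR0 ?gt_eqF//; exact: powR_cvg0. Qed.

Lemma continuous_powR_gt0 (b v : R) : 0 < v -> {for v, continuous (fun v : R => v `^ b)}.
Proof.
move=> v0; apply: differentiable_continuous; apply/derivable1_diffP.
by apply: derivable_powR; rewrite in_itv /= v0.
Qed.

Lemma balakrishnan_within_continuous (b l : R) : 0 < b -> 0 < l ->
  {within `[0, +oo[, continuous (balakrishnan b l)}.
Proof.
move=> b0 l0; apply/continuous_within_itvcyP; split.
  move=> v; rewrite in_itv /= andbT => v0; apply: cvgM; first exact: cvg_cst.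
  apply: cvgV; first by rewrite gt_eqF// ltr_pwDl// powR_ge0.
  by apply: cvgD; [exact: cvg_cst|exact: continuous_powR_gt0].
apply: cvgM; first exact: cvg_cst.
apply: cvgV; first by rewrite gt_eqF// ltr_pwDl// powR_ge0.
by apply: cvgD; [exact: cvg_cst|exact: powR_right_continuous].
Qed.

Lemma measurable_balakrishnan (b l : R) (D : set R) : 0 < b -> 0 < l ->
  measurable D -> D `<=` `[0, +oo[ -> measurable_fun D (balakrishnan b l).
Proof.
move=> b0 l0 mD D0.
have mB : measurable_fun (`[0%R, +oo[%classic : set R) (balakrishnan b l).
  apply: subspace_continuous_measurable_fun => //.
  exact: balakrishnan_within_continuous.
by apply: measurable_funS mB.
Qed.

(** Substitution v = l^(1/b) u: then v^b = l u^b and l cancels from the kernel, leaving the factor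
    l^(1/b) of dv. *)
Lemma balakrishnan_scaling (b l : R) : 0 < b -> 0 < l ->
  (\int[mu]_(v in `[0%R, +oo[) (balakrishnan b l v)%:E =
   (l `^ b^-1)%:E * \int[mu]_(v in `[0%R, +oo[) (balakrishnan b 1 v)%:E)%E.
Proof.
move=> b0 l0; set c := l `^ b^-1; have c0 : 0 < c by rewrite powR_gt0.
have dF (v : R) : is_derive v 1 (fun v : R => c * v) c := is_derive_scale c v.
have F' : ((fun v : R => c * v)^`())%classic = cst c.
  by apply/funext => v; rewrite derive1E; exact: derive_val.
have := @increasing_ge0_integration_by_substitutiony R (fun v => c * v) (balakrishnan b l) 0.
rewrite mulr0 => ->.
- rewrite -ge0_integralZl//.
  + apply: eq_integral => v; rewrite inE /= in_itv /= andbT => v0.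
    rewrite F' -EFinM /=; congr EFin.
    change (balakrishnan b l (c * v) * c = c * balakrishnan b 1 v).
    rewrite /balakrishnan powRM ?(ltW c0)// -powRrM mulVf ?gt_eqF// powRr1 ?ltW//.
    rewrite mulrC; congr (c * _).
    by rewrite -[X in l / (X + _)]mulr1 -mulrDr invfM mulrA divff ?gt_eqF.
  + by apply/measurable_EFinP; apply: measurable_balakrishnan.
  + by move=> v _; rewrite lee_fin balakrishnan_ge0.
  + by rewrite lee_fin ltW.
- by move=> x y _ _; rewrite ltr_pM2l.
- by rewrite F' => x _; exact: cvg_cst.
- by rewrite F'; apply/cvg_ex; exists c; exact: cvg_cst.
- by rewrite F'; apply/cvg_ex; exists c; exact: cvg_cst.
- split=> [x _|]; first by exact: ex_derive.
  by apply: cvgM; [exact: cvg_cst|apply: cvg_at_right_filter; exact: cvg_id].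
- apply/cvgryPge => A; apply: filterS (nbhs_pinfty_ge (num_real (A / c))) => x /=.
  by rewrite ler_pdivrMr// mulrC.
- exact: balakrishnan_within_continuous.
- by move=> v _; exact/balakrishnan_ge0/ltW.
Qed.

Lemma powR_cvg_pinfty0 (c : R) : 0 < c -> v `^ (- c) @[v --> +oo] --> (0 : R).
Proof.
move=> c0; apply/cvgrPdist_le => e e0.
apply: filterS2 (nbhs_pinfty_gt (num_real 0))
  (nbhs_pinfty_gt (num_real (e^-1 `^ c^-1))) => v v0 ve.
rewrite sub0r normrN ger0_norm ?powR_ge0// powRN.
rewrite -[leRHS]invrK lef_pV2 ?posrE ?invr_gt0 ?powR_gt0//.
have -> : e^-1 = (e^-1 `^ c^-1) `^ c.
  by rewrite -powRrM mulVf ?gt_eqF// powRr1// invr_ge0 ltW.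
by apply: ge0_ler_powR; rewrite ?nnegrE ?powR_ge0 ?ltW.
Qed.

Lemma integral_powR_tail (b : R) : 1 < b ->
  (\int[mu]_(v in `[1%R, +oo[) (v `^ (- b))%:E < +oo)%E.
Proof.
move=> b1; pose c := b - 1; have c0 : 0 < c by rewrite subr_gt0.
pose F (v : R) := - c^-1 * v `^ (- c).
have dF (v : R) : 0 < v -> is_derive v 1 F (v `^ (- b)).
  move=> v0; have := is_derive1_powR (- c) v0 => H.
  have -> : v `^ (- b) = - c^-1 * (- c * v `^ (- c - 1)).
    rewrite mulrA mulrNN mulVf ?gt_eqF// mul1r; congr (_ `^ _).
    by rewrite /c; ring.
  exact: (@is_deriveZ R R R _ (- c^-1) v 1 _ H).
rewrite (@ge0_continuous_FTC2y R (fun v => v `^ (- b)) F 1 0).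
- by rewrite -EFinB ltry.
- by move=> v _; exact: powR_ge0.
- apply: continuous_in_subspaceT => v; rewrite inE /= in_itv /= andbT => v1.
  by apply: continuous_powR_gt0; apply: lt_le_trans v1.
- by rewrite -(mulr0 (- c^-1)); apply: cvgM; [exact: cvg_cst|exact: powR_cvg_pinfty0].
- by move=> v v1; have := dF v (lt_trans ltr01 v1) => ?; exact: ex_derive.
- apply: cvg_at_right_filter; apply: cvgM; first exact: cvg_cst.
  exact: continuous_powR_gt0.
- move=> v; rewrite in_itv /= andbT => v1; rewrite derive1E.
  by have := dF v (lt_trans ltr01 v1) => ?; exact: derive_val.
Qed.

(** The kernel is at most 1 on [0, 1) and at most v^(-b) beyond; the tail converges because b > 1,
    that is s < 2. *)
Lemma balakrishnan_integral_lty (b : R) : 1 < b ->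
  (\int[mu]_(v in `[0%R, +oo[) (balakrishnan b 1 v)%:E < +oo)%E.
Proof.
move=> b1; have b0 : 0 < b := lt_trans ltr01 b1.
have mB D := @measurable_balakrishnan b 1 D b0 ltr01.
have D01 : `[0%R, +oo[%classic = `[0, 1[ `|` `[1, +oo[%classic :> set R.
  by rewrite -(@itv_bndbnd_setU _ _ (BLeft 0) (BLeft 1)) ?bnd_simp.
rewrite D01 ge0_integral_setU//=; first last.
- rewrite disj_set2E; apply/eqP/seteqP; split => //= v.
  by rewrite /= !in_itv /= andbT => -[/andP[_ v1]]; rewrite leNgt v1.
- by move=> v _; rewrite lee_fin balakrishnan_ge0.
- by rewrite -D01; apply/measurable_EFinP; apply: mB.
apply: lte_add_pinfty.
  apply: (@le_lt_trans _ _ (\int[mu]_(v in `[0%R, 1%R[) 1%:E)%E).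
    apply: ge0_le_integral => //.
    - by move=> v _; rewrite lee_fin balakrishnan_ge0.
    - apply/measurable_EFinP; apply: mB => // v /=; rewrite !in_itv /= andbT.
      by case/andP.
    - by move=> v _; rewrite lee_fin ler_pdivrMr ?ltr_pwDl ?powR_ge0// mul1r lerDl powR_ge0.
  by rewrite integral_cst//= lebesgue_measure_itv /= lte_fin ltr01 oppr0 adde0 mule1 ltry.
apply: le_lt_trans (integral_powR_tail b1).
apply: ge0_le_integral => //.
- by move=> v _; rewrite lee_fin balakrishnan_ge0.
- apply/measurable_EFinP; apply: mB => // v /=; rewrite !in_itv /= !andbT.
  exact: le_trans.
- apply/measurable_EFinP; apply: measurable_funS (measurable_powR _) => //.
- move=> v; rewrite /= in_itv /= andbT => v1; rewrite lee_fin powRN /balakrishnan div1r.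
  have v0 : 0 < v `^ b by rewrite powR_gt0// (lt_le_trans ltr01).
  by rewrite lef_pV2 ?posrE// ?addr_gt0// lerDr.
Qed.

Lemma balakrishnan_integral_gt0 (b : R) : 0 < b ->
  (0 < \int[mu]_(v in `[0%R, +oo[) (balakrishnan b 1 v)%:E)%E.
Proof.
move=> b0; have mB D := @measurable_balakrishnan b 1 D b0 ltr01.
apply: (@lt_le_trans _ _ (\int[mu]_(v in `[0%R, 1%R]) (2^-1)%:E)%E).
  rewrite integral_cst//= lebesgue_measure_itv /= lte_fin ltr01 oppr0 adde0.
  by rewrite mule1 lte_fin invr_gt0.
have D01 : `[0%R, 1%R] `<=` (`[0%R, +oo[%classic : set R).
  by move=> v /=; rewrite !in_itv /= andbT => /andP[].
apply: (@le_trans _ _ (\int[mu]_(v in `[0%R, 1%R]) (balakrishnan b 1 v)%:E)%E); last first.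
  apply: ge0_subset_integral => //.
  - by apply/measurable_EFinP; apply: mB.
  - by move=> v _; rewrite lee_fin balakrishnan_ge0.
apply: ge0_le_integral => //.
- by apply/measurable_EFinP; apply: mB.
- move=> v; rewrite /= in_itv /= => /andP[v0 v1]; rewrite lee_fin /balakrishnan div1r.
  have vb1 : v `^ b <= 1.
    have -> : 1 = 1 `^ b :> R by rewrite powR1.
    by apply: ge0_ler_powR; rewrite ?nnegrE//; exact: ltW.
  rewrite lef_pV2 ?posrE ?ltr_pwDl ?powR_ge0//.
  by rewrite [2]mulr2n lerD2l.
Qed.

(** The origin is removed since the resolvent bound needs t = v^b > 0; the integrals are
    unchanged. *)
Local Notation D := (`]0%R, +oo[%classic : set R).

Definition balakrishnan_int (b l : R) : R := \int[mu]_(v in D) balakrishnan b l v.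

Lemma balakrishnan_int_closed (b l : R) : 0 < b -> 0 < l ->
  (\int[mu]_(v in D) (balakrishnan b l v)%:E =
   \int[mu]_(v in `[0%R, +oo[) (balakrishnan b l v)%:E)%E.
Proof.
move=> b0 l0; apply: integral_itv_obnd_cbnd.
apply/measurable_EFinP; apply: measurable_balakrishnan => // v /=.
by rewrite !in_itv /= !andbT => /ltW.
Qed.

Lemma balakrishnan_integrable (b l : R) : 1 < b -> 0 <= l ->
  mu.-integrable D (EFin \o balakrishnan b l).
Proof.
move=> b1; have b0 : 0 < b := lt_trans ltr01 b1; rewrite le_eqVlt => /predU1P[<-|l0].
  rewrite (_ : EFin \o _ = cst 0%E); first exact: integrable0.
  by apply/funext => v /=; rewrite /balakrishnan mul0r.
apply/integrableP; split.
  apply/measurable_EFinP; apply: measurable_balakrishnan => // v /=.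
  by rewrite !in_itv /= !andbT => /ltW.
under eq_integral do rewrite /= ger0_norm ?balakrishnan_ge0 ?ltW//.
rewrite balakrishnan_int_closed// balakrishnan_scaling//.
by rewrite lte_mul_pinfty// ?lee_fin ?powR_ge0// balakrishnan_integral_lty.
Qed.

Lemma balakrishnan_intE (b l : R) : 1 < b -> 0 <= l ->
  balakrishnan_int b l = l `^ b^-1 * balakrishnan_int b 1.
Proof.
move=> b1; have b0 : 0 < b := lt_trans ltr01 b1; rewrite le_eqVlt => /predU1P[<-|l0].
  (* The zero frequency: at l = 0 the kernel vanishes, and so does 0^(1/b). *)
  rewrite powR0 ?invr_eq0 ?gt_eqF// mul0r /balakrishnan_int.
  rewrite (_ : balakrishnan b 0 = cst 0) ?Rintegral_cst ?mul0r//.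
  by apply/funext => v; rewrite /balakrishnan mul0r.
rewrite /balakrishnan_int /Rintegral !balakrishnan_int_closed// balakrishnan_scaling//.
rewrite fineM// fin_numElt (lt_trans (ltNyr 0)) ?balakrishnan_integral_gt0//.
exact: balakrishnan_integral_lty.
Qed.

Lemma balakrishnan_int_gt0 (b : R) : 1 < b -> 0 < balakrishnan_int b 1.
Proof.
move=> b1; have b0 : 0 < b := lt_trans ltr01 b1.
rewrite /balakrishnan_int /Rintegral fine_gt0// balakrishnan_int_closed//.
by rewrite balakrishnan_integral_gt0//= balakrishnan_integral_lty.
Qed.

Lemma integrable_balakrishnan_sum (I : Type) (s : seq I) (d l : I -> R) (b : R) :
  1 < b -> (forall p, 0 <= l p) ->
  mu.-integrable D (EFin \o (fun v => \sum_(p <- s) d p * balakrishnan b (l p) v)).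
Proof.
move=> b1 l0; elim: s => [|p s IH].
  rewrite (_ : EFin \o _ = cst 0%E); first exact: integrable0.
  by apply/funext => v /=; rewrite big_nil.
rewrite (_ : EFin \o _ = (fun v => (d p)%:E * (balakrishnan b (l p) v)%:E +
    (\sum_(p <- s) d p * balakrishnan b (l p) v)%:E)%E); last first.
  by apply/funext => v /=; rewrite big_cons EFinD EFinM.
apply: integrableD => //.
by apply: integrableZl => //; exact: balakrishnan_integrable.
Qed.

Lemma Rintegral_balakrishnan_sum (I : Type) (s : seq I) (d l : I -> R) (b : R) :
  1 < b -> (forall p, 0 <= l p) ->
  \int[mu]_(v in D) (\sum_(p <- s) d p * balakrishnan b (l p) v) =
  (\sum_(p <- s) d p * (l p) `^ b^-1) * balakrishnan_int b 1.
Proof.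
move=> b1 l0; elim: s => [|p s IH].
  rewrite big_nil mul0r; under eq_Rintegral do rewrite big_nil.
  by rewrite Rintegral_cst// mul0r.
under eq_Rintegral do rewrite big_cons.
have iB := balakrishnan_integrable b1 (l0 p).
rewrite RintegralD//; last 2 first.
- rewrite (_ : EFin \o _ = (fun v => (d p)%:E * (balakrishnan b (l p) v)%:E)%E).
    exact: integrableZl.
  by apply/funext => v /=; rewrite EFinM.
- exact: integrable_balakrishnan_sum.
rewrite IH RintegralZl// -/(balakrishnan_int b (l p)) balakrishnan_intE//.
by rewrite big_cons mulrDl mulrA.
Qed.

(** With t = v^b, A (t + A)^-1 p is p - t (t + A)^-1 p, hence at most 2 P, and it is also (t + A)^-1
    (A p), hence at most Q / t. Adding the first bound to t times the second gives the factor 1 +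
    t. *)
Lemma moment_bound {n} (s : seq (R[i] * 'rV[int]_n)) (P Q b : R) : 1 < b ->
  (forall x, normc (trig (fun=> 1) s x) <= P) ->
  (forall x, normc (trig lam s x) <= Q) ->
  forall x, normc (trig (fun nu => lam nu `^ b^-1) s x) <= 2 * P + Q.
Proof.
move=> b1 sP sQ x; have I0 := balakrishnan_int_gt0 b1.
rewrite -(ler_pM2r I0).
(* The phase at the fixed point x makes the numbers [d p] real, so a real integral over v
   suffices. *)
have [w w1 wz] := normc_phase (trig (fun nu => lam nu `^ b^-1) s x).
pose d (p : R[i] * 'rV[int]_n) := Re (w * (p.1 * chi p.2 x)).
have dE (m : 'rV[int]_n -> R) : Re (w * trig m s x) = \sum_(p <- s) d p * m p.2.
  rewrite mulr_sumr cRe_sum; apply: eq_bigr => p _.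
  by rewrite -mulrA mulrCA Re_real_mul mulrC.
have -> : normc (trig (fun nu => lam nu `^ b^-1) s x) =
    \sum_(p <- s) d p * lam p.2 `^ b^-1.
  by rewrite -[RHS](dE (fun nu => lam nu `^ b^-1)) wz.
have l0 (p : R[i] * 'rV[int]_n) : 0 <= lam p.2 :> R by exact: lam_ge0.
rewrite -(@Rintegral_balakrishnan_sum _ s d (fun p => lam p.2) b)//.
have iB1 := @balakrishnan_integrable b 1 b1 ler01.
(* The integrands are compared pointwise: [balakrishnan b 1 v] is 1 / (1 + v^b), the very majorant
   that the two resolvent estimates give. *)
rewrite -RintegralZl//; apply: le_Rintegral => //.
- exact: (integrable_balakrishnan_sum s d b1 l0).
- rewrite (_ : EFin \o _ = (fun v => (2 * P + Q)%:E * (balakrishnan b 1 v)%:E)%E).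
    exact: integrableZl.
  by apply/funext => v /=; rewrite EFinM.
move=> v; rewrite /= in_itv /= andbT => v0.
pose t := v `^ b; have t0 : 0 < t by rewrite powR_gt0.
have lt_neq0 nu : t + lam nu != 0 :> R by rewrite gt_eqF// ltr_pwDl// lam_ge0.
pose m (nu : 'rV[int]_n) : R := lam nu / (t + lam nu).
have -> : \sum_(p <- s) d p * balakrishnan b (lam p.2) v = Re (w * trig m s x).
  by rewrite dE; apply: eq_bigr => p _; rewrite /m addrC.
rewrite /balakrishnan mulrA mulr1 ler_pdivlMr ?addr_gt0//.
apply: (@le_trans _ _ (normc (trig m s x) * (1 + t))).
  apply: ler_wpM2r; first by rewrite addr_ge0// ltW.
  apply: le_trans (ler_norm _) _.
  by apply: le_trans (ler_Re_normc _) _; rewrite normcM w1 mul1r.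
rewrite mulrDr mulr1; apply: lerD.
  have qP := @trig_resolvent_bound _ _ t P (fun nu => (t + lam nu)^-1) s t0.
  have -> : trig m s x = trig (fun=> 1) s x - t%:C * trig (fun nu => (t + lam nu)^-1) s x.
    apply/eqP; rewrite eq_sym subr_eq addrC -trig_linear; apply/eqP; congr trig.
    by apply/funext => nu; rewrite /m -mulrDl mulfV.
  apply: le_trans (normcD _ _) _; rewrite (_ : 2 * P = P + P); last by ring.
  apply: lerD => //; rewrite (@normcN R) normcM normc_real gtr0_norm//.
  rewrite mulrC -ler_pdivlMr//; apply: qP => y.
  by under eq_fun do rewrite mulfV//.
rewrite -ler_pdivlMr//; apply: trig_resolvent_bound => // y.
rewrite (_ : (fun nu => _) = lam)//.
by apply/funext => nu; rewrite /m mulrCA divff// mulr1.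
Qed.

End MomentInequality.

(** * Fejer means *)

Section Fejer.
Context {R : realType} {n : nat}.
Implicit Types (f : 'rV[R]_n -> R[i]) (x y : 'rV[R]_n).

Lemma fourier_coefE f nu : fourier_coef f nu =
  ((2 * pi) ^- n)%:C * torus_int (fun x => f x * chi (- nu) x).
Proof.
by congr (_ * torus_int _); apply/funext => x; rewrite /chi freq_dotNl.
Qed.

Lemma torus_contC_coef f nu : torus_contC f -> torus_contC (fun x => f x * chi nu x).
Proof. by move=> cf; apply: torus_contCM => //; exact: torus_contC_chi. Qed.

Lemma torus_contC_chi_sub nu x : torus_contC (fun y => chi nu (x - y)).
Proof.
rewrite (_ : (fun _ => _) = (fun y => chi nu x * chi (- nu) y)).
  by apply: torus_contCZ; exact: torus_contC_chi.
by apply/funext => y; rewrite chiDr chiN.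
Qed.

Lemma torus_int_chi_sub nu x :
  torus_int (fun y => chi nu (x - y)) = ((2 * pi) ^+ n)%:C * (nu == 0)%:R.
Proof.
rewrite (_ : (fun _ => _) = (fun y => chi nu x * chi (- nu) y)); last first.
  by apply/funext => y; rewrite chiDr chiN.
rewrite torus_intZ ?torus_int_chi ?oppr_eq0; last exact: torus_contC_chi.
by have [->|_] := eqVneq nu 0; rewrite ?chi0 ?mul1r ?mulr1 ?mulr0.
Qed.

Section Kernel.
Variable N : nat.
Let idx := {ffun 'I_n -> 'I_N.+1}.

Definition freq_row (k : idx) : 'rV[int]_n := \row_j (k j : nat)%:Z.

Definition freq_diff (p : idx * idx) : 'rV[int]_n := freq_row p.1 - freq_row p.2.

(** Without the normalisation (N + 1)^-n. As a sum over pairs of points of the cube {0, ..., N}^n it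
    is a squared modulus, hence nonnegative, and its moments count pairs. *)
Definition fejer_kernel x : R[i] := \sum_(p <- enum {: idx * idx}) chi (freq_diff p) x.

(** One entry per pair: the usual Fejer weight of a frequency is the number of times it is repeated,
    divided by (N + 1)^n. *)
Definition fejer_seq f : seq (R[i] * 'rV[int]_n) :=
  [seq ((N.+1%:R ^- n)%:C * fourier_coef f (freq_diff p), freq_diff p)
  | p <- enum {: idx * idx}].

Lemma fejer_kernelE x :
  fejer_kernel x = (normc (\sum_(k : idx) chi (freq_row k) x) ^+ 2)%:C.
Proof.
rewrite -mulc_conj rmorph_sum big_distrlr /= /fejer_kernel big_enum /=.
rewrite pair_bigA /=; apply: eq_bigr => p _.
by rewrite [LHS]chiDl -chi_conj.
Qed.

Lemma trig_fejer m f x : trig m (fejer_seq f) x =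
  (N.+1%:R ^- n)%:C * \sum_(p <- enum {: idx * idx})
    (m (freq_diff p))%:C * fourier_coef f (freq_diff p) * chi (freq_diff p) x.
Proof.
rewrite /trig /fejer_seq big_map mulr_sumr; apply: eq_bigr => p _ /=.
by rewrite mulrCA !mulrA.
Qed.

Lemma torus_contC_fejer_sub x : torus_contC (fun y => fejer_kernel (x - y)).
Proof. by apply: torus_contC_sum => p; exact: torus_contC_chi_sub. Qed.

Lemma fejer_convolution f x : torus_contC f ->
  trig (fun=> 1) (fejer_seq f) x =
  (((2 * pi) ^+ n * N.+1%:R ^+ n)^-1)%:C * torus_int (fun y => f y * fejer_kernel (x - y)).
Proof.
move=> cf; have -> : torus_int (fun y => f y * fejer_kernel (x - y)) =
    \sum_(p <- enum {: idx * idx})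
      chi (freq_diff p) x * torus_int (fun y => f y * chi (- freq_diff p) y).
  rewrite (_ : (fun y => f y * _) = (fun y => \sum_(p <- enum {: idx * idx})
      chi (freq_diff p) x * (f y * chi (- freq_diff p) y))).
    rewrite torus_int_sum => [|p]; last by apply: torus_contCZ; exact: torus_contC_coef.
    by apply: eq_bigr => p _; rewrite torus_intZ//; exact: torus_contC_coef.
  apply/funext => y; rewrite mulr_sumr; apply: eq_bigr => p _.
  by rewrite chiDr -chiN mulrCA.
rewrite trig_fejer !mulr_sumr; apply: eq_bigr => p _.
rewrite mul1r fourier_coefE invfM rmorphM /=; ring.
Qed.

(** Orthogonality of characters turns the integral into a count of pairs. *)
Lemma fejer_moment kappa x :
  torus_int (fun y => chi kappa (x - y) * fejer_kernel (x - y)) =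
  ((2 * pi) ^+ n)%:C * #|[set p : idx * idx | kappa + freq_diff p == 0]%SET|%:R.
Proof.
rewrite (_ : (fun _ => _) = (fun y => \sum_(p <- enum {: idx * idx})
    chi (kappa + freq_diff p) (x - y))); last first.
  by apply/funext => y; rewrite mulr_sumr; apply: eq_bigr => p _; rewrite chiDl.
rewrite torus_int_sum; last by move=> p; exact: torus_contC_chi_sub.
under eq_bigr do rewrite torus_int_chi_sub.
rewrite -mulr_sumr; congr (_ * _); rewrite big_enum /= -natr_sum; congr (_%:R).
by rewrite -sum1dep_card [RHS]big_mkcond /=; apply: eq_bigr => p _; case: eqP.
Qed.

Lemma freq_row_inj : injective freq_row.
Proof.
move=> k l /rowP kl; apply/ffunP => j; apply/val_inj.
by have := kl j; rewrite !mxE => -[].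
Qed.

Lemma card_freq_diff0 : #|[set p : idx * idx | 0 + freq_diff p == 0]%SET| = (N.+1 ^ n)%N.
Proof.
transitivity #|[set (k, k) | k : idx]%SET|.
  apply: eq_card => -[k l]; rewrite inE /freq_diff add0r subr_eq0 /=.
  apply/eqP/imsetP => [/freq_row_inj ->|[i _ [-> ->]]//]; by exists l.
by rewrite card_imset ?card_ffun ?card_ord// => k l [].
Qed.

(** The product form avoids the exponent n - 1. *)
Lemma card_freq_top (j : 'I_n) :
  (#|[set k : idx | k j == ord_max]%SET| * N.+1 = N.+1 ^ n)%N.
Proof.
pose F i := if i == j then pred1 (@ord_max N) else predT.
have -> : #|[set k : idx | k j == ord_max]%SET| = #|(family F : simpl_pred idx)|.
  apply: eq_card => k; rewrite inE; apply/idP/familyP => [kj i|/(_ j)].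
    by rewrite /F; case: eqP => [->|].
  by rewrite /F eqxx.
rewrite card_family foldrE big_map big_enum /= (bigD1 j)//= {1}/F eqxx card1 mul1n.
rewrite (eq_bigr (fun=> N.+1)); last first.
  by move=> i ij; rewrite /F (negbTE ij) card_ord.
rewrite prod_nat_const -expnSr; congr (_ ^ _)%N.
rewrite (@eq_card _ _ (predC1 j)) => [|i]; last by rewrite !inE.
by rewrite cardC1 card_ord prednK// (leq_ltn_trans (leq0n j)).
Qed.

(* The frequencies k such that k + e_j leaves the cube {0, ..., N}^n are those with
   k j = N. *)
Lemma card_freq_diff_delta (j : 'I_n) :
  (N.+1 ^ n <= #|[set p : idx * idx | (delta_mx 0 j + freq_diff p == 0)%R]%SET|
               + #|[set k : idx | k j == ord_max]%SET|)%N.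
Proof.
(* [up k] is k + e_j; it is used only when k j < N, where [inord] does not fall back on its
   default. *)
pose up (k : idx) : idx := [ffun i => if i == j then inord (k i).+1 else k i].
rewrite -[X in (X ^ _)%N]card_ord -[X in (_ ^ X)%N]card_ord -card_ffun.
rewrite -(cardC [set k : idx | k j == ord_max]%SET) addnC leq_add2r.
rewrite -(@card_in_imset _ _ (fun k => (k, up k))); last by move=> k l _ _ [].
apply: subset_leq_card; apply/fintype.subsetP => _ /imsetP[k kN ->].
rewrite inE /freq_diff /=; apply/eqP/rowP => i; rewrite !mxE ffunE eqxx /=.
have [->|ij] := eqVneq i j; last by rewrite add0r subrr.
have kjN : ((k j).+1 < N.+1)%N.
  rewrite ltn_neqAle ltn_ord andbT; apply: contra kN => /eqP kjN.
  by rewrite !inE; apply/eqP/val_inj => /=; case: kjN.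
by rewrite inordK// intS opprD [X in _ + X]addrCA subrr addr0 subrr.
Qed.

End Kernel.

Lemma period_eq f (k : 'rV[int]_n) x : torus_contC f -> f (x + period k) = f x.
Proof.
move=> /torus_contCP[pf _]; exact: period_coord.
Qed.

Lemma chi_delta (j : 'I_n) x : chi (delta_mx 0 j) x = expi (x 0 j).
Proof.
rewrite /chi /freq_dot (bigD1 j)//= big1 ?addr0 => [|k kj]; rewrite mxE eqxx.
  by rewrite eqxx mul1r.
by rewrite (negbTE kj) mul0r.
Qed.

(* The modulus of continuity in the form needed by Korovkin's argument: the right
   side is integrated exactly against the Fejer kernel. *)
Lemma korovkin_modulus f : torus_contC f -> forall e : R, 0 < e ->
  exists2 C : R, 0 <= C & forall x y, normc (f y - f x) <=
    e + C * \sum_j (1 - Re (chi (delta_mx 0 j) (x - y))).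
Proof.
move=> cf e e0; have [d d0 fd] := torus_contC_unif_cont cf e0.
have [M fM] := torus_contC_bounded cf.
have M0 : 0 <= M by apply: le_trans (fM 0); exact: normc_ge0.
(* The cap at 1, which is below pi, keeps d1 where cos is decreasing, so 1 - cos d1 > 0. *)
pose d1 := Num.min d 1; have d10 : 0 < d1 by rewrite lt_min d0 ltr01.
have d1pi : d1 <= pi by rewrite ge_min; apply/orP; right; have := pi_ge2 R; lra.
have c0 : 0 < 1 - cos d1.
  by rewrite subr_gt0 -[ltRHS]cos0 ltr_cos// in_itv /= ?lexx ?pi_ge0// ltW.
have CM0 : 0 <= 2 * M / (1 - cos d1) by apply: divr_ge0; [exact: mulr_ge0|exact: ltW].
exists (2 * M / (1 - cos d1)) => [//|x y].
have term0 j (t : 'rV[R]_n) : 0 <= 1 - Re (chi (delta_mx 0 j) t).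
  by rewrite chi_delta /= subr_ge0 cos_le1.
have [k yk] := period_centred (y - x).
set y' := y + period k.
have fy : f y' = f y by exact: period_eq.
have ce j : Re (chi (delta_mx 0 j) (x - y)) = Re (chi (delta_mx 0 j) (x - y')).
  congr Re; rewrite opprD addrA.
  rewrite -[RHS](period_eq k _ (torus_contC_chi (delta_mx 0 j))).
  by rewrite subrK.
(* Near x, uniform continuity gives e. Otherwise some centred coordinate of y - x has modulus
   between d1 and pi, its term in the sum is at least 1 - cos d1, and this pays for the trivial
   bound 2 M. *)
have [xy'|] := pselect (near_coord d1 y' x).
  rewrite -fy; apply: le_trans (fd _ _ _) _.
    by move=> i; apply: le_trans (xy' i) _; rewrite ge_min lexx.
  by rewrite lerDl mulr_ge0 ?sumr_ge0.
move=> /existsNP[j /negP]; rewrite -ltNge => xyj.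
apply: (@le_trans _ _ (2 * M / (1 - cos d1) * (1 - Re (chi (delta_mx 0 j) (x - y))))).
  rewrite mulrAC ler_pdivlMr//; apply: ler_pM.
  - exact: normc_ge0.
  - exact: ltW.
  - apply: le_trans (normcD _ _) _; rewrite (@normcN R) mulr2n mulrDl mul1r.
    exact: lerD.
  - rewrite lerD2l lerN2 ce chi_delta /=.
    have -> : (x - y') 0 j = - (y' 0 j - x 0 j) by rewrite !mxE; ring.
    rewrite cosN -cos_norm ltW// ltr_cos// in_itv /= ?normr_ge0 ?(ltW d10)//=.
    by have := yk j; rewrite /y' !mxE addrAC.
apply: ler_wpDl; first exact: ltW.
apply: ler_wpM2l => //.
by rewrite (bigD1 j)//= lerDl sumr_ge0.
Qed.

(** The nonnegative kernel has total mass K, so the Korovkin modulus can be integrated against it;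
    the cost of each coordinate is the defect of one first moment, a fraction at most 1 / (N + 1) of
    K. *)
Lemma fejer_approx f : torus_contC f -> forall e : R, 0 < e ->
  \forall N \near \oo, forall x, normc (trig (fun=> 1) (fejer_seq N f) x - f x) <= e.
Proof.
move=> cf e e0; have e2 : 0 < e / 2 by rewrite divr_gt0.
have [C C0 fC] := korovkin_modulus cf e2.
(* This choice makes C n / (N + 1) at most e / 2. *)
have : \forall N \near \oo, (2 * C * n%:R / e) <= N%:R :> R by exact: nbhs_infty_ger.
apply: filterS => N NC x.
set K : R := (2 * pi) ^+ n * N.+1%:R ^+ n.
have K0 : 0 < K by rewrite mulr_gt0// exprn_gt0 ?twopi_gt0.
pose F y := fejer_kernel N (x - y); pose G y := Re (F y).
have FG y : F y = (G y)%:C by rewrite /G /F fejer_kernelE.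
have G0 y : 0 <= G y by rewrite /G /F fejer_kernelE /= sqr_ge0.
have cF : torus_contC F := torus_contC_fejer_sub N x.
have cG : torus_cont G := cF.1.
have intF : torus_int F = K%:C.
  have := fejer_moment N 0 x; rewrite card_freq_diff0 natrX.
  rewrite /K rmorphM /= (_ : (N.+1%:R ^+ n)%:C = N.+1%:R ^+ n); last by rewrite rmorphXn rmorph_nat.
  move=> <-.
  by congr torus_int; apply/funext => y; rewrite chi0 mul1r.
have intG : torus_Rint G = K by have := congr1 Re intF.
pose c (j : 'I_n) y := Re (chi (delta_mx 0 j) (x - y)).
have cc j : torus_cont (c j) := (torus_contC_chi_sub (delta_mx 0 j) x).1.
(* Translation by e_j moves only a fraction 1 / (N + 1) of the cube outside it. *)
have intc j : K - torus_Rint (fun y => c j y * G y) <= K / N.+1%:R.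
  have -> : torus_Rint (fun y => c j y * G y) =
      (2 * pi) ^+ n * #|[set p | delta_mx 0 j + @freq_diff N p == 0]%SET|%:R.
    have := congr1 Re (fejer_moment N (delta_mx 0 j) x).
    have ReN (k : nat) : Re (k%:R : R[i]) = k%:R by rewrite -(rmorph_nat (real_complex R)).
    rewrite Re_real_mul ReN => <-.
    congr torus_Rint; apply/funext => y /=.
    by rewrite -/(F y) FG cReM /= mulr0 subr0.
  rewrite /K -mulrBr -mulrA ler_wpM2l ?exprn_ge0 ?(ltW twopi_gt0)//.
  have := card_freq_diff_delta N j.
  rewrite -(ler_nat R) natrD natrX -lerBlDl => /le_trans; apply.
  by rewrite ler_pdivlMr ?ltr0Sn// -natrM card_freq_top natrX.
rewrite fejer_convolution// -/K.
have -> : f x = K^-1%:C * (f x * torus_int F).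
  by rewrite intF mulrCA -rmorphM /= mulVf ?mulr1 ?gt_eqF.
rewrite -mulrBr -torus_intZ// -torus_intB; last 2 first.
- exact: torus_contCM.
- exact: torus_contCZ.
rewrite normcM normc_real ger0_norm ?invr_ge0 ?(ltW K0)// mulrC ler_pdivrMr//.
pose H y := (e / 2 * G y + C * \sum_j (G y - c j y * G y)).
have cterm j : torus_cont (fun y => G y - c j y * G y).
  by apply: torus_contB => //; exact: torus_contM.
have csum := torus_cont_sum (index_enum 'I_n) cterm.
have cH : torus_cont H.
  by apply: torus_contD; exact: torus_contZ.
apply: (@le_trans _ _ (torus_Rint H)).
  apply: normc_torus_int => //.
    by apply: torus_contCB; [exact: torus_contCM|exact: torus_contCZ].
  move=> y; rewrite -/(F y) -mulrBl normcM FG normc_real ger0_norm//.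
  have -> : H y = (e / 2 + C * \sum_j (1 - c j y)) * G y.
    rewrite /H mulrDl -[C * _ * _]mulrA mulr_suml; congr (_ + _ * _).
    by apply: eq_bigr => j _; rewrite mulrBl mul1r.
  by apply: ler_wpM2r => //; exact: fC.
have intH : torus_Rint H = e / 2 * K + C * \sum_j (K - torus_Rint (fun y => c j y * G y)).
  rewrite /H torus_RintD; [|exact: torus_contZ|exact: torus_contZ].
  rewrite !torus_RintZ// intG; congr (_ + _ * _).
  rewrite torus_Rint_sum//; apply: eq_bigr => j _.
  rewrite -intG -[torus_Rint G]mul1r addrC -mulN1r -!torus_RintZ//; last exact: torus_contM.
  rewrite -torus_RintD; [|by apply/torus_contZ/torus_contM|exact: torus_contZ].
  by congr torus_Rint; apply/funext => y; ring.
rewrite intH.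
have : \sum_j (K - torus_Rint (fun y => c j y * G y)) <= n%:R * (K / N.+1%:R).
  apply: le_trans (ler_sum _ (fun j _ => intc j)) _.
  by rewrite sumr_const card_ord mulr_natl.
move=> /(ler_wpM2l C0) sumK; rewrite [e in leRHS]splitr mulrDl lerD2l.
apply: le_trans sumK _; clearbody K.
rewrite !mulrA ler_pdivrMr ?ltr0Sn//.
have -> : e / 2 * K * N.+1%:R = (e / 2 * N.+1%:R) * K by ring.
rewrite (ler_pM2r K0).
move: NC; rewrite ler_pdivrMr// => NC.
have : N%:R * e <= N.+1%:R * e by rewrite ler_pM2r// ler_nat.
move: NC; generalize (N%:R : R) (N.+1%:R : R) => p q; lra.
Qed.

End Fejer.

(** * Fourier coefficients of derivatives *)

Section Derivatives.
Context {R : realType} {n : nat}.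
Implicit Types (f : 'rV[R]_n -> R[i]) (x y : 'rV[R]_n).

Lemma is_derive_line (u : 'rV[R]_n -> R) x (v : 'rV[R]_n) (d : R) :
  is_derive x v u d <-> is_derive (0 : R) 1 (fun h : R => u (x + h *: v)) d.
Proof.
pose g (h : R) := u (x + h *: v).
have E : (fun h : R => h^-1 *: ((u \o shift x) (h *: v) - u x)) =
         (fun h : R => h^-1 *: ((g \o shift 0) (h *: (1 : R)) - g 0)).
  apply/funext => h /=; rewrite /g scale0r addr0 addr0 [h *: 1]mulr1.
  by rewrite [x + _]addrC.
split=> -[dx dE].
  by apply: DeriveDef; rewrite /derivable /derive -/g -E.
by apply: DeriveDef; rewrite /derivable /derive E.
Qed.

Lemma is_derive_along (u : 'rV[R]_n -> R) (v : 'rV[R]_n) x (t : R) :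
  (forall y, derivable u y v) ->
  is_derive t 1 (fun h : R => u (x + h *: v)) ('D_v u (x + t *: v)).
Proof.
move=> du; have /is_derive_line dt : is_derive (x + t *: v) v u ('D_v u (x + t *: v)).
  by apply: DeriveDef.
have -> : (fun h : R => u (x + h *: v)) =
    (fun h => (fun k : R => u (x + t *: v + k *: v)) (h - t)).
  by apply/funext => h /=; rewrite -addrA -scalerDl [t + _]addrC subrK.
apply: (@is_derive_shift R (fun k : R => u (x + t *: v + k *: v))).
by rewrite subrr.
Qed.

(** By the mean value theorem the quotient is the partial derivative at a point at distance less
    than h. Uniformity in x permits the passage to the limit under the integral. *)
Lemma uniform_difference_quotient (u : 'rV[R]_n -> R) (j : 'I_n) :
  (forall y, derivable u y (delta_mx 0 j)) ->
  torus_cont ('D_(delta_mx 0 j) u) -> forall e : R, 0 < e ->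
  \forall h \near 0^'+, forall x,
    `|(u (x + h *: delta_mx 0 j) - u x) / h - 'D_(delta_mx 0 j) u x| <= e.
Proof.
move=> du cdu e e0; have [d d0 Dd] := torus_unif_cont cdu e0.
near=> h => x; have h0 : 0 < h by near: h; exact: nbhs_right_gt.
have hd : h <= d by near: h; exact: nbhs_right_le.
pose F (t : R) := u (x + t *: delta_mx 0 j).
have dF (t : R) : is_derive t 1 F ('D_(delta_mx 0 j) u (x + t *: delta_mx 0 j)).
  exact: is_derive_along.
have cF : {within `[0, h], continuous F}.
  by apply: derivable_within_continuous => t _; exact: ex_derive.
have [c ch Fc] := @MVT R F _ 0 h h0 (fun t _ => dF t) cF.
move: Fc; rewrite /F scale0r addr0 subr0 => ->.
rewrite mulfK ?gt_eqF//; apply: Dd => i; rewrite add_delta_coord addrAC subrr add0r.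
move: ch; rewrite in_itv /= => /andP[c0 ch].
case: (i == j); last by rewrite mulr0 normr0 ltW.
by rewrite mulr1 gtr0_norm// (le_trans (ltW ch)).
Unshelve. all: by end_near. Qed.

Lemma torus_C_partial k f (j : 'I_n) : torus_C k.+1 f -> torus_C k (partial j f).
Proof.
move=> [pf [_ Hf]]; split; last exact: (Hf j).2.
move=> x i; rewrite /partial.
have per (u : 'rV[R]_n -> R) : (forall y, u (y + (2 * pi) *: delta_mx 0 i) = u y) ->
    'D_(delta_mx 0 j) u (x + (2 * pi) *: delta_mx 0 i) = 'D_(delta_mx 0 j) u x.
  move=> pu; rewrite /derive.
  suff -> : (fun h : R => h^-1 *: ((u \o shift (x + (2 * pi) *: delta_mx 0 i)) (h *: delta_mx 0 j)
      - u (x + (2 * pi) *: delta_mx 0 i))) =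
    (fun h : R => h^-1 *: ((u \o shift x) (h *: delta_mx 0 j) - u x)) by [].
  by apply/funext => h /=; rewrite addrA !pu.
by rewrite !per// => y; rewrite /= pf.
Qed.

Lemma torus_C0 k f : torus_C k f -> torus_contC f.
Proof. by move=> [pf cf]; apply/torus_contCP; split=> //; case: k cf => [|k] []. Qed.

(* Both sides are limits of integrals of difference quotients, moved onto the
   exponential by translation invariance; no product rule is needed. *)
Lemma torus_int_partial f nu (j : 'I_n) : torus_C 1 f ->
  torus_int (fun x => partial j f x * chi nu x) =
  (- ((nu 0 j)%:~R : R)%:C * 'i) * torus_int (fun x => f x * chi nu x).
Proof.
move=> f1; have cf := torus_C0 f1.
have [cp1 cp2] := torus_C0 (torus_C_partial j f1).
have [_ [_ /(_ j)[df _]]] := f1.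
have d1 y : derivable (fun x => Re (f x)) y (delta_mx 0 j) := (df y).1.
have d2 y : derivable (fun x => Im (f x)) y (delta_mx 0 j) := (df y).2.
set I := torus_int (fun x => f x * chi nu x); set a : R := (nu 0 j)%:~R.
apply/eqP; rewrite -subr_eq0; apply/eqP/eq0_normc/eqP.
rewrite -normr_le0 ger0_norm ?normc_ge0//; apply/ler_addgt0Pl => e e0; rewrite addr0.
(* 2 (2 pi)^n is the cost of replacing the partial derivative by the quotient [q], 2 |I| that of
   replacing (expi (- a h) - 1) / h by its limit - i a. *)
pose P := 2 * (2 * pi) ^+ n + 2 * normc I.
have p0 : 0 < (2 * pi) ^+ n :> R by rewrite exprn_gt0 ?twopi_gt0.
have P0 : 0 < P.
  by rewrite ltr_wpDr ?mulr_gt0// mulr_ge0// normc_ge0.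
have eP : 0 < e / P by rewrite divr_gt0.
have u1 := uniform_difference_quotient d1 cp1 eP.
have u2 := uniform_difference_quotient d2 cp2 eP.
have u3 : \forall h \near 0^'+, `|- a - sin (- a * h) / h| <= e / P.
  by move/cvg_dnbhs_at_right/cvgrPdist_le : (@sin_quotient_cvg R (- a)); exact.
have u4 : \forall h \near 0^'+, `|0 - (cos (- a * h) - 1) / h| <= e / P.
  by move/cvg_dnbhs_at_right/cvgrPdist_le : (@cos_quotient_cvg R (- a)); exact.
have [h [q1 q2 [q3 q4 h0]]] : exists h : R,
    [/\ forall x, `|(Re (f (x + h *: delta_mx 0 j)) - Re (f x)) / h -
          'D_(delta_mx 0 j) (fun x => Re (f x)) x| <= e / P,
        forall x, `|(Im (f (x + h *: delta_mx 0 j)) - Im (f x)) / h -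
          'D_(delta_mx 0 j) (fun x => Im (f x)) x| <= e / P
      & [/\ `|- a - sin (- a * h) / h| <= e / P,
            `|0 - (cos (- a * h) - 1) / h| <= e / P & 0 < h]].
  near (0 : R)^'+ => h; exists h; split; first by near: h.
    by near: h.
  by split; [near: h|near: h|near: h; exact: nbhs_right_gt].
pose q x := (h^-1)%:C * (f (x + h *: delta_mx 0 j) - f x).
have cq : torus_contC q.
  by apply: torus_contCZ; apply: torus_contCB => //; exact: torus_contC_shift.
(* Translation invariance moves the difference from f to the character. *)
have Iq : torus_int (fun x => q x * chi nu x) = (h^-1)%:C * (expi (- a * h) - 1) * I.
  have -> : (fun x => q x * chi nu x) = (fun x => (h^-1)%:C *
      (expi (- a * h) * (f (x + h *: delta_mx 0 j) * chi nu (x + h *: delta_mx 0 j))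
       - f x * chi nu x)).
    apply/funext => x; rewrite /q chi_shift -/a -mulrA mulrBl; congr (_ * (_ - _)).
    rewrite [RHS]mulrC -!mulrA -expiD mulNr subrr expi0.
    by rewrite mulr1.
  have cfc := torus_contC_coef nu cf.
  have cfs := torus_contC_shift (h *: delta_mx 0 j) cfc.
  rewrite torus_intZ; last by apply: torus_contCB => //; exact: torus_contCZ.
  rewrite torus_intB//; last exact: torus_contCZ.
  rewrite torus_intZ// (torus_int_shift j h cfc) -/I -mulrA; congr (_ * _).
  by rewrite mulrBl mul1r.
have qp x : normc (partial j f x - q x) <= 2 * (e / P).
  apply: le_trans (normc_le_ReIm _) _; rewrite mulr_natl mulr2n; apply: lerD.
    have := q1 x; rewrite distrC; apply: le_trans; rewrite le_eqVlt; apply/orP; left.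
    apply/eqP; congr `|_|; rewrite /q; case: (f x) => ? ?; case: (f (x + _)) => ? ? /=.
    by rewrite mul0r subr0; congr (_ - _); rewrite mulrC.
  have := q2 x; rewrite distrC; apply: le_trans; rewrite le_eqVlt; apply/orP; left.
  apply/eqP; congr `|_|; rewrite /q; case: (f x) => ? ?; case: (f (x + _)) => ? ? /=.
  by rewrite mul0r addr0; congr (_ - _); rewrite mulrC.
apply: le_trans (normc_dist (torus_int (fun x => q x * chi nu x)) _ _) _.
have -> : e = (2 * pi) ^+ n * (2 * (e / P)) + (e / P + e / P) * normc I.
  by rewrite /P; field; rewrite gt_eqF.
apply: lerD.
  rewrite -torus_intB; [|exact: torus_contC_coef (torus_C0 (torus_C_partial j f1))
                        |exact: torus_contC_coef].
  apply: normc_torus_int_le.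
    by apply: torus_contCB; apply: torus_contC_coef => //;
      exact: torus_C0 (torus_C_partial j f1).
  by move=> x; rewrite -mulrBl normcM normc_chi mulr1.
rewrite Iq -mulrBl normcM ler_wpM2r ?normc_ge0//.
apply: le_trans (normc_le_ReIm _) _; rewrite addrC; apply: lerD.
  move: q3; rewrite distrC /expi /=; congr (`|_| <= _); field.
  by rewrite gt_eqF.
move: q4; rewrite sub0r normrN /expi /=; congr (`|_| <= _); field.
by rewrite gt_eqF.
Unshelve. all: by end_near. Qed.

Lemma fourier_coef_partial f nu (j : 'I_n) : torus_C 1 f ->
  fourier_coef (partial j f) nu = (((nu 0 j)%:~R : R)%:C * 'i) * fourier_coef f nu.
Proof.
move=> f1; rewrite !fourier_coefE torus_int_partial// mxE mulrNz.
by rewrite rmorphN /= opprK mulrCA.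
Qed.

Lemma fourier_coef_partial2 f nu (j : 'I_n) : torus_C 2 f ->
  fourier_coef (partial j (partial j f)) nu =
  - (((nu 0 j)%:~R : R) ^+ 2)%:C * fourier_coef f nu.
Proof.
move=> f2; have f1 : torus_C 1 f.
  case: f2 => [pf [cf Hf]].
  exact: (conj pf (conj cf (fun i => conj (Hf i).1 (conj (Hf i).2.1 I)))).
rewrite fourier_coef_partial; last exact: torus_C_partial.
rewrite fourier_coef_partial// mulrA; congr (_ * _).
rewrite mulrACA -rmorphM -expr2 /=; rewrite -expr2 sqr_i mulrN1.
by [].
Qed.

Lemma fourier_coef_sum (I : Type) (s : seq I) (F : I -> 'rV[R]_n -> R[i]) nu :
  (forall j, torus_contC (F j)) ->
  fourier_coef (fun x => \sum_(j <- s) F j x) nu = \sum_(j <- s) fourier_coef (F j) nu.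
Proof.
move=> cF; rewrite fourier_coefE.
under [in RHS]eq_bigr do rewrite fourier_coefE.
rewrite -mulr_sumr -torus_int_sum; last by move=> j; exact: torus_contC_coef.
by congr (_ * torus_int _); apply/funext => x; rewrite mulr_suml.
Qed.

Lemma torus_contC_laplacian f : torus_C 2 f -> torus_contC (laplacian f).
Proof.
move=> f2; apply: torus_contC_sum => j.
by apply: (@torus_C0 0); do 2!apply: torus_C_partial.
Qed.

Lemma fourier_coef_laplacian f nu : torus_C 2 f ->
  fourier_coef (laplacian f) nu = - (lam nu)%:C * fourier_coef f nu.
Proof.
move=> f2; rewrite fourier_coef_sum; last first.
  by move=> j; apply: (@torus_C0 0); do 2!apply: torus_C_partial.
under eq_bigr do rewrite fourier_coef_partial2//.
by rewrite -mulr_suml sumrN rmorph_sum.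
Qed.

(** The factor c makes the family closed under partial derivatives, as the induction proving
    smoothness requires. *)
Lemma partial_chi (c : R[i]) nu (j : 'I_n) :
  partially_derivable j (fun x : 'rV[R]_n => c * chi nu x) /\
  partial j (fun x : 'rV[R]_n => c * chi nu x) =
  (fun x => (c * ((nu 0 j)%:~R : R)%:C * 'i) * chi nu x).
Proof.
have dchi (a b : R) x : is_derive x (delta_mx 0 j)
    (fun y : 'rV[R]_n => a * cos (freq_dot nu y) + b * sin (freq_dot nu y))
    ((nu 0 j)%:~R * (b * cos (freq_dot nu x) - a * sin (freq_dot nu x))).
  apply/is_derive_line; set t := freq_dot nu x; set m : R := (nu 0 j)%:~R.
  have -> : (fun h : R => a * cos (freq_dot nu (x + h *: delta_mx 0 j)) +
      b * sin (freq_dot nu (x + h *: delta_mx 0 j))) =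
    (fun h : R => (a * cos t + b * sin t) * cos (m * h) + (b * cos t - a * sin t) * sin (m * h)).
    apply/funext => h; rewrite freq_dotDr freq_dot_delta cosD sinD -/t -/m; ring.
  have -> : m * (b * cos t - a * sin t) =
      (a * cos t + b * sin t) * (- sin (m * 0) * m) + (b * cos t - a * sin t) * (cos (m * 0) * m).
    by rewrite mulr0 sin0 cos0; ring.
  have D1 := is_derive_cos_scale m 0; have D2 := is_derive_sin_scale m 0.
  by apply: is_deriveD; exact: is_deriveZ.
have reE : (fun x : 'rV[R]_n => Re (c * chi nu x)) =
    (fun y => Re c * cos (freq_dot nu y) + (- Im c) * sin (freq_dot nu y)).
  by apply/funext => x; rewrite cReM mulNr.
have imE : (fun x : 'rV[R]_n => Im (c * chi nu x)) =
    (fun y => Im c * cos (freq_dot nu y) + Re c * sin (freq_dot nu y)).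
  by apply/funext => x; rewrite cImM addrC.
have d1 x : is_derive x (delta_mx 0 j) (Re \o (fun x : 'rV[R]_n => c * chi nu x)) _ :=
  eq_ind_r (fun u => is_derive x (delta_mx 0 j) u _) (dchi (Re c) (- Im c) x) reE.
have d2 x : is_derive x (delta_mx 0 j) (Im \o (fun x : 'rV[R]_n => c * chi nu x)) _ :=
  eq_ind_r (fun u => is_derive x (delta_mx 0 j) u _) (dchi (Im c) (Re c) x) imE.
split=> [x|].
  by split; [have := d1 x|have := d2 x] => ?; exact: ex_derive.
apply/funext => x; rewrite /partial.
have -> := @derive_val _ _ _ _ _ _ _ (d1 x).
have -> := @derive_val _ _ _ _ _ _ _ (d2 x).
by case: c {reE imE d1 d2 dchi} => a b; rewrite /chi /expi; apply: complexP => /=; ring.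
Qed.

Lemma torus_smooth_chi nu : torus_smooth (@chi R n nu).
Proof.
have H k (c : R[i]) : torus_C k (fun x : 'rV[R]_n => c * chi nu x).
  have [p0 [c0 _]] : torus_C 0 (fun x : 'rV[R]_n => c * chi nu x).
    by apply/torus_contCP; apply: torus_contCZ; exact: torus_contC_chi.
  elim: k c p0 c0 => [|k IH] c p0 c0; first by [].
  split=> //; split=> // j; have [pd ->] := partial_chi c nu j; split=> //.
  have /torus_contCP[p1 [c1 _]] : torus_contC
      (fun x : 'rV[R]_n => (c * ((nu 0 j)%:~R : R)%:C * 'i) * chi nu x).
    by apply: torus_contCZ; exact: torus_contC_chi.
  exact: (IH _ p1 c1).2.
move=> k; rewrite (_ : chi nu = (fun x => 1 * chi nu x))//.
by apply/funext => x; rewrite mul1r.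
Qed.

End Derivatives.

(** * The fractional Laplacian of a smooth function *)

Section UnorderedSums.
Context {R : realType} {I : choiceType}.
Variables (d : I -> R) (S : R).
Hypothesis dS : forall A : {fset I}, \sum_(j <- A) d j <= S.

Lemma fset_sum_split (V : nmodType) (A B : {fset I}) (F : I -> V) : (A `<=` B)%fset ->
  \sum_(j <- B) F j = \sum_(j <- A) F j + \sum_(j <- B | j \notin A) F j.
Proof.
move=> AB; rewrite (bigID (mem A)) /=; congr (_ + _).
rewrite -big_filter; apply: perm_big; apply: uniq_perm.
- exact/filter_uniq/fset_uniq.
- exact: fset_uniq.
by move=> j; rewrite mem_filter; case: (boolP (j \in A)) => //= /(fsubsetP AB) ->.
Qed.

(** A0 nearly attains the supremum of the partial sums of d, so it depends on d alone and serves all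
    dominated families at once; hence uniformity in x later. *)
Lemma dominated_tail (e : R) : 0 < e -> exists A0 : {fset I},
  forall (b : I -> R[i]), (forall j, normc (b j) <= d j) ->
  forall A : {fset I}, (A0 `<=` A)%fset ->
    normc (\sum_(j <- A) b j - \sum_(j <- A0) b j) <= e.
Proof.
move=> e0; pose E := [set \sum_(j <- A) d j | A in [set: {fset I}]].
have supE : has_sup E.
  split; first by exists (\sum_(j <- fset0) d j), fset0.
  by exists S => _ [A _ <-].
have [_ [A0 _ <-] A0e] := sup_adherent e0 supE.
exists A0 => b bd A A0A; rewrite (fset_sum_split b A0A) addrAC subrr add0r.
apply: le_trans (normc_sum _ _ _) _.
apply: le_trans (ler_sum _ (fun j _ => bd j)) _.
have : \sum_(j <- A) d j <= sup E by apply: sup_upper_bound => //; exists A.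
rewrite (fset_sum_split d A0A); move: A0e; lra.
Qed.

Lemma dominated_partial_sum_cvg (b : I -> R[i]) : (forall j, normc (b j) <= d j) ->
  exists L : R[i], partial_sum (b : I -> R[i]^o) A @[A --> totally] --> (L : R[i]^o).
Proof.
move=> bd; have FT : ProperFilter (@totally I) := totally_filter.
pose p (A : {fset I}) := \sum_(j <- A) b j.
have psE (A : {fset I}) : partial_sum (b : I -> R[i]^o) A = p A.
  by rewrite /partial_sum /p big_seq_fsetE.
have comp (g : R[i] -> R) : (forall z w, `|g z - g w| <= normc (z - w)) ->
    cvg (g (p A) @[A --> (@totally I)]).
  move=> g1; set F := fmap _ _; have FF : ProperFilter F.
    by apply: fmap_proper_filter; exact: totally_filter.
  apply: (@cauchy_cvgP R F FF).1.
  have : cauchy_ex (F : set_system R); last exact: cauchy_exP.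
  move=> e e0; have [A0 A0b] := dominated_tail (divr_gt0 e0 (ltr0Sn R 1)).
  exists (g (p A0)); exists A0 => //= A A0A.
  rewrite /ball /= distrC; apply: le_lt_trans (g1 _ _) _.
  apply: le_lt_trans (A0b b bd A A0A) _.
  by rewrite ltr_pdivrMr// ltr_pMr// ltr1n.
have gRe (z w : R[i]) : `|Re z - Re w| <= normc (z - w).
  by have := ler_Re_normc (z - w); case: z w => ? ? [].
have gIm (z w : R[i]) : `|Im z - Im w| <= normc (z - w).
  by have := ler_Im_normc (z - w); case: z w => ? ? [].
have /cvg_ex[a ac] := comp (fun z => Re z) gRe.
have /cvg_ex[c cc] := comp (fun z => Im z) gIm.
exists (a +i* c); apply/cvgcP => e e0.
have e2 : 0 < e / 2 by rewrite divr_gt0.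
have na : \forall A \near (@totally I), `|a - Re (p A)| <= e / 2.
  by move/cvgrPdist_le : ac; exact.
have nc : \forall A \near (@totally I), `|c - Im (p A)| <= e / 2.
  by move/cvgrPdist_le : cc; exact.
apply: filterS2 na nc => A; rewrite psE; case: (p A) => q r pa qc.
by apply: le_trans (normc_le_ReIm _) _; rewrite [leRHS]splitr; exact: lerD.
Qed.

Lemma dominated_sum_approx (X : Type) (a : X -> I -> R[i]) :
  (forall x j, normc (a x j) <= d j) -> forall e : R, 0 < e ->
  exists A0 : {fset I}, forall A : {fset I}, (A0 `<=` A)%fset -> forall x,
    normc (sum (a x : I -> R[i]^o) - \sum_(j <- A) a x j) <= e.
Proof.
move=> ad e e0; have FT : ProperFilter (@totally I) := totally_filter.
have e3 : 0 < e / 3 by rewrite divr_gt0.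
have [A0 A0a] := dominated_tail e3; exists A0 => A A0A x.
have [L aL] := dominated_partial_sum_cvg (ad x).
have -> : sum (a x : I -> R[i]^o) = L by apply: cvg_lim aL; exact: norm_hausdorff.
have nL : \forall A \near (@totally I),
    normc (L - partial_sum (a x : I -> R[i]^o) A) <= e / 3.
  by move/cvgcP : aL; exact.
have nA0 : \forall A \near (@totally I), (A0 `<=` A)%fset by exists A0.
(* B is close to the limit and contains A0: the errors are limit to B, B to A0, and A0 to A. *)
have [B [BL A0B]] := filter_ex (filterI nL nA0).
apply: le_trans (normc_dist (\sum_(j <- B) a x j) _ _) _.
have BL' : normc (L - \sum_(j <- B) a x j) <= e / 3.
  by move: BL; rewrite /partial_sum big_seq_fsetE.
apply: le_trans (lerD BL' (normc_dist (\sum_(j <- A0) a x j) _ _)) _.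
have h1 := A0a _ (ad x) _ A0B; have h2 := A0a _ (ad x) _ A0A.
rewrite [leRHS](_ : e = e / 3 + (e / 3 + e / 3)); last by field.
by rewrite lerD2l lerD// normcB.
Qed.

End UnorderedSums.

(** * Decay of the Fourier coefficients of smooth functions, and duality *)

Section Decay.
Context {R : realType} {n : nat}.

(** The product form lets the sum of the inverses factor over coordinates, and, being a polynomial
    in the nu_j^2, the weight is controlled by second partial derivatives. *)
Definition freq_weight (nu : 'rV[int]_n) : R := \prod_j (1 + (nu 0 j)%:~R ^+ 2).

Lemma freq_weight_gt0 nu : 0 < freq_weight nu.
Proof. by apply: prodr_gt0 => j _; rewrite ltr_pwDl// sqr_ge0. Qed.

(** The correction 2 / (N + 1) makes the induction telescope: 1 / (1 + (k + 1)^2) <= 2 / (k + 1) - 2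
    / (k + 2). *)
Lemma sum_inv_sqr_bound N : \sum_(k < N.+1) (1 + (k%:R : R) ^+ 2)^-1 <= 3 - 2 / N.+1%:R.
Proof.
elim: N => [|N IH].
  by rewrite big_ord_recr big_ord0 /= expr0n /= addr0 invr1 add0r; lra.
rewrite big_ord_recr /=; apply: le_trans (lerD IH (lexx _)) _.
rewrite -!natr1; set k : R := N%:R; have k0 : 0 <= k by rewrite ler0n.
have k1 : 0 < k + 1 by lra. have k2 : 0 < k + 1 + 1 by lra.
have q0 : 0 < 1 + (k + 1) ^+ 2 by rewrite ltr_pwDl// sqr_ge0.
suff : (1 + (k + 1) ^+ 2)^-1 <= 2 / (k + 1) - 2 / (k + 1 + 1) by lra.
have -> : 2 / (k + 1) - 2 / (k + 1 + 1) = 2 / ((k + 1) * (k + 1 + 1)).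
  by field; rewrite !gt_eqF.
rewrite -[leLHS]mul1r ler_pdivrMr// mulrAC ler_pdivlMr ?mulr_gt0//.
by rewrite mul1r; nra.
Qed.

(** Each coordinate is coded by its sign and its modulus, at most N on the finite set A; the sum
    over all codes is a product of n equal sums, and 6 is two signs times the bound 3. *)
Lemma freq_weight_summable (A : {fset 'rV[int]_n}) :
  \sum_(nu <- A) (freq_weight nu)^-1 <= 6 ^+ n.
Proof.
pose N := (\sum_(nu : A) \sum_j `|(val nu) 0%R j|)%N.
have NA (nu : A) j : (`|(val nu) 0%R j| < N.+1)%N.
  rewrite ltnS /N (bigD1 nu)//= (bigD1 j)//= -addnA.
  exact: leq_addr.
pose T := (bool * 'I_N.+1)%type.
pose h (nu : A) : {ffun 'I_n -> T} :=
  [ffun j => (0 <= (val nu) 0 j, Ordinal (NA nu j))].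
have h_inj : injective h.
  move=> nu1 nu2 /ffunP h12; apply/val_inj/rowP => j.
  have := h12 j; rewrite !ffunE => -[s12 /= a12].
  case: (val nu1 0 j) (val nu2 0 j) s12 a12 => [k|k] [l|l] //= _.
    by move=> ->.
  by move=> [->].
pose D (k : T) : R := (1 + (k.2 : nat)%:R ^+ 2)^-1.
have D0 k : 0 <= D k by rewrite invr_ge0 addr_ge0// sqr_ge0.
have wh (nu : A) : (freq_weight (val nu))^-1 = \prod_j D (h nu j).
  rewrite /freq_weight -prodfV; apply: eq_bigr => j _; rewrite ffunE /D /=.
  congr ((1 + _)^-1); rewrite [in RHS]natr_absz intr_norm.
  by rewrite real_normK// num_real.
rewrite big_seq_fsetE /=; under eq_bigr do rewrite wh.
rewrite -(@big_imset _ _ _ _ _ h predT (fun k => \prod_j D (k j))); last first.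
  by move=> ? ? _ _; exact: h_inj.
apply: (@le_trans _ _ (\sum_(k : {ffun 'I_n -> T}) \prod_j D (k j))).
  rewrite [leRHS](bigID (mem (h @: predT)%SET)) /= lerDl.
  by apply: sumr_ge0 => k _; apply: prodr_ge0.
rewrite -(bigA_distr_bigA (fun (_ : 'I_n) k => D k)).
rewrite prodr_const card_ord lerXn2r ?nnegrE ?sumr_ge0//.
rewrite -(pair_bigA _ (fun b k => D (b, k))) /= big_bool /D /=.
have s3 : \sum_(k < N.+1) (1 + (k%:R : R) ^+ 2)^-1 <= 3.
  by apply: le_trans (sum_inv_sqr_bound N) _; rewrite gerBl divr_ge0.
by rewrite (_ : 6 = 3 + 3) ?lerD// -natrD.
Qed.

Lemma torus_smooth_partial (phi : 'rV[R]_n -> R[i]) j :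
  torus_smooth phi -> torus_smooth (partial j phi).
Proof. by move=> sphi k; exact: torus_C_partial. Qed.

(** Quantifying over all smooth phi lets the weight gain a factor nu_j^2: the bound is applied to a
    second partial derivative of phi. *)
Definition coef_controlled (w : 'rV[int]_n -> R) := forall phi : 'rV[R]_n -> R[i],
  torus_smooth phi -> exists B : R, forall nu, w nu * normc (fourier_coef phi nu) <= B.

Lemma coef_controlled1 : coef_controlled (fun=> 1).
Proof.
move=> phi sphi; have cphi := torus_C0 (sphi 0%N).
have [M phiM] := torus_contC_bounded cphi.
exists (`|(2 * pi) ^- n| * ((2 * pi) ^+ n * M)) => nu.
rewrite mul1r fourier_coefE normcM normc_real ler_wpM2l//.
apply: normc_torus_int_le => [|x]; first exact: torus_contC_coef.
by rewrite normcM normc_chi mulr1.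
Qed.

Lemma coef_controlledD w1 w2 : coef_controlled w1 -> coef_controlled w2 ->
  coef_controlled (fun nu => w1 nu + w2 nu).
Proof.
move=> c1 c2 phi sphi; have [B1 b1] := c1 _ sphi; have [B2 b2] := c2 _ sphi.
by exists (B1 + B2) => nu; rewrite mulrDl lerD.
Qed.

Lemma coef_controlled_sqr w (j : 'I_n) : coef_controlled w ->
  coef_controlled (fun nu => (nu 0 j)%:~R ^+ 2 * w nu).
Proof.
move=> cw phi sphi.
have [B wB] := cw _ (torus_smooth_partial j (torus_smooth_partial j sphi)).
exists B => nu; apply: le_trans (wB nu).
rewrite fourier_coef_partial2; last exact: sphi.
rewrite [normc (- _ * _)]normcM (@normcN R) normc_real ger0_norm ?sqr_ge0//.
by rewrite [leRHS]mulrCA [leRHS]mulrA.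
Qed.

(** The factor 1 + lam pays for the symbol, whatever s in (0, 2]; [freq_weight] pays for the
    summation. *)
Lemma coef_controlled_weight : coef_controlled (fun nu => (1 + lam nu) * freq_weight nu).
Proof.
have cW : coef_controlled freq_weight.
  rewrite /freq_weight; elim: (index_enum _) => [|j s IH].
    rewrite (_ : (fun _ => _) = fun=> 1); first exact: coef_controlled1.
    by apply/funext => nu; rewrite big_nil.
  rewrite (_ : (fun _ => _) = (fun nu : 'rV[int]_n =>
      \prod_(i <- s) (1 + (nu 0 i)%:~R ^+ 2) +
      (nu 0 j)%:~R ^+ 2 * \prod_(i <- s) (1 + (nu 0 i)%:~R ^+ 2))).
    by apply: coef_controlledD => //; exact: coef_controlled_sqr.
  by apply/funext => nu; rewrite big_cons mulrDl mul1r.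
rewrite (_ : (fun _ => _) = (fun nu => freq_weight nu + lam nu * freq_weight nu)).
  apply: coef_controlledD => //; rewrite /lam.
  elim: (index_enum _) => [|j s IH].
    rewrite (_ : (fun _ => _) = fun=> 0).
      by move=> phi _; exists 0 => nu; rewrite mul0r.
    by apply/funext => nu; rewrite big_nil mul0r.
  rewrite (_ : (fun _ => _) = (fun nu : 'rV[int]_n => (nu 0 j)%:~R ^+ 2 * freq_weight nu +
      (\sum_(i <- s) (nu 0 i)%:~R ^+ 2) * freq_weight nu)).
    by apply: coef_controlledD => //; exact: coef_controlled_sqr.
  by apply/funext => nu; rewrite big_cons mulrDl.
by apply/funext => nu; rewrite mulrDl mul1r.
Qed.

Definition symbol (s : R) (nu : 'rV[int]_n) : R := freq_norm nu `^ s.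

Lemma freq_normE (nu : 'rV[int]_n) : freq_norm nu = Num.sqrt (lam nu) :> R.
Proof. by []. Qed.

Lemma symbol_lam (s : R) nu : symbol s nu = lam nu `^ (s / 2).
Proof.
rewrite /symbol freq_normE -powR12_sqrt ?lam_ge0// -powRrM; congr (_ `^ _).
by rewrite mulrC.
Qed.

Lemma symbol_le (s : R) nu : 0 < s -> s <= 2 -> symbol s nu <= 1 + lam nu.
Proof.
move=> s0 s2; rewrite symbol_lam; have l0 := @lam_ge0 R n nu.
have [l1|/ltW l1] := leP (lam nu) (1 : R).
  apply: (@le_trans _ _ 1); last by rewrite lerDl.
  rewrite -[leRHS](_ : 1 `^ (s / 2) = 1); last by rewrite powR1.
  by apply: ge0_ler_powR; rewrite ?nnegrE// divr_ge0// ltW.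
apply: (@le_trans _ _ (lam nu)); last by rewrite lerDr.
rewrite -[leRHS]powRr1//; apply: ler_powR => //.
by rewrite ler_pdivrMr// mul1r.
Qed.

Section FracLaplacianSmooth.
Variables (s : R) (phi : 'rV[R]_n -> R[i]).
Hypotheses (s0 : 0 < s) (s2 : s <= 2) (sphi : torus_smooth phi).

Lemma frac_lap_smooth_approx (e : R) : 0 < e ->
  exists A0 : {fset 'rV[int]_n}, forall A : {fset 'rV[int]_n}, (A0 `<=` A)%fset ->
  forall x, normc (frac_lap_smooth s phi x -
    \sum_(nu <- A) (symbol s nu)%:C * fourier_coef phi nu * chi nu x) <= e.
Proof.
have [B phiB] := coef_controlled_weight sphi.
have B0 : 0 <= B.
  apply: le_trans (phiB 0); rewrite mulr_ge0 ?normc_ge0// mulr_ge0//.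
    by rewrite addr_ge0// lam_ge0.
  exact/ltW/freq_weight_gt0.
have dS (A : {fset 'rV[int]_n}) : \sum_(nu <- A) B * (freq_weight nu)^-1 <= B * 6 ^+ n.
  by rewrite -mulr_sumr ler_wpM2l// freq_weight_summable.
apply: (dominated_sum_approx dS) => x nu.
rewrite (normcM (_ * _)) normc_expi mulr1 normcM normc_real ger0_norm ?powR_ge0//.
rewrite ler_pdivlMr ?freq_weight_gt0//; apply: le_trans (phiB nu).
rewrite mulrAC; apply: ler_wpM2r; first exact: normc_ge0.
by apply: ler_wpM2r; [exact/ltW/freq_weight_gt0|exact: symbol_le].
Qed.

Lemma torus_contC_frac_lap_smooth : torus_contC (frac_lap_smooth s phi).
Proof.
apply: torus_contC_unif_lim => e /frac_lap_smooth_approx[A0 A0e].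
exists (fun x => \sum_(nu <- A0) (symbol s nu)%:C * fourier_coef phi nu * chi nu x).
  by apply: torus_contC_sum => nu; apply: torus_contCZ; exact: torus_contC_chi.
by move=> x; exact: A0e.
Qed.

Lemma symbolN nu : symbol s (- nu) = symbol s nu.
Proof.
rewrite !symbol_lam; congr (_ `^ _); apply: eq_bigr => j _.
by rewrite mxE mulrNz sqrrN.
Qed.

(** Integration against [chi kappa] extracts the frequency - kappa, and the symbol is even. *)
Lemma frac_lap_smooth_dual_chi kappa :
  torus_int (fun x => chi kappa x * frac_lap_smooth s phi x) =
  (symbol s kappa)%:C * torus_int (fun x => chi kappa x * phi x).
Proof.
have cphi : torus_contC phi := torus_C0 (sphi 0%N).
have cf := torus_contC_frac_lap_smooth.
have cchi k : torus_contC (@chi R n k) := torus_contC_chi k.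
have p0 : 0 < (2 * pi) ^+ n :> R by rewrite exprn_gt0 ?twopi_gt0.
apply/eqP; rewrite -subr_eq0; apply/eqP/eq0_normc/eqP.
rewrite -normr_le0 ger0_norm ?normc_ge0//; apply/ler_addgt0Pl => e e0; rewrite addr0.
have [A0 A0e] := frac_lap_smooth_approx (divr_gt0 e0 p0).
(* The frequency - kappa is forced into the set, being the only one that survives orthogonality. *)
pose A := ((- kappa) |` A0)%fset.
have AA0 : (A0 `<=` A)%fset by rewrite fsubsetU1.
have kA : - kappa \in A by rewrite in_fset1U eqxx.
pose g x := \sum_(nu <- A) (symbol s nu)%:C * fourier_coef phi nu * chi nu x.
have cg : torus_contC g by apply: torus_contC_sum => nu; exact: torus_contCZ.
have -> : (symbol s kappa)%:C * torus_int (fun x => chi kappa x * phi x) =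
    torus_int (fun x => chi kappa x * g x).
  rewrite (_ : (fun x => chi kappa x * g x) = (fun x => \sum_(nu <- A)
      (symbol s nu)%:C * fourier_coef phi nu * chi (kappa + nu) x)); last first.
    apply/funext => x; rewrite /g mulr_sumr; apply: eq_bigr => nu _.
    by rewrite chiDl mulrCA.
  rewrite torus_int_sum; last by move=> nu; exact: torus_contCZ.
  rewrite (bigD1_seq (- kappa)) ?fset_uniq//= big1 ?addr0 => [|nu nuk]; last first.
    by rewrite torus_intZ// torus_int_chi addrC addr_eq0 (negbTE nuk) mulr0.
  rewrite torus_intZ// torus_int_chi subrr eqxx symbolN -mulrA; congr (_ * _).
  rewrite fourier_coefE opprK mulrAC -rmorphM /= mulVf ?gt_eqF// mul1r.
  by congr torus_int; apply/funext => x; rewrite mulrC.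
rewrite -torus_intB; [|exact: torus_contCM|exact: torus_contCM].
apply: (@le_trans _ _ ((2 * pi) ^+ n * (e / (2 * pi) ^+ n))); last first.
  by rewrite mulrC divfK// gt_eqF.
apply: normc_torus_int_le => [|x].
  by apply: torus_contCB; exact: torus_contCM.
by rewrite -mulrBr normcM normc_chi mul1r; exact: A0e.
Qed.

Lemma frac_lap_smooth_dual p :
  torus_int (fun x => trig (fun=> 1) p x * frac_lap_smooth s phi x) =
  torus_int (fun x => trig (symbol s) p x * phi x).
Proof.
have cphi : torus_contC phi := torus_C0 (sphi 0%N).
have cf := torus_contC_frac_lap_smooth.
have cchi k : torus_contC (@chi R n k) := torus_contC_chi k.
rewrite (_ : (fun x => _) = (fun x => \sum_(q <- p)
    q.1 * (chi q.2 x * frac_lap_smooth s phi x))); last first.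
  by apply/funext => x; rewrite mulr_suml; apply: eq_bigr => q _; rewrite mul1r mulrA.
rewrite [in RHS](_ : (fun x => _) = (fun x => \sum_(q <- p)
    ((symbol s q.2)%:C * q.1) * (chi q.2 x * phi x))); last first.
  by apply/funext => x; rewrite mulr_suml; apply: eq_bigr => q _; rewrite !mulrA.
rewrite !torus_int_sum => [|q|q]; try by apply: torus_contCZ; exact: torus_contCM.
apply: eq_bigr => q _; rewrite !torus_intZ ?frac_lap_smooth_dual_chi; try exact: torus_contCM.
by rewrite mulrCA mulrA.
Qed.

End FracLaplacianSmooth.
End Decay.

(** * The fractional Laplacian of a function of class C^2 *)

Section FracLaplacian.
Context {R : realType} {n : nat}.
Implicit Types (f g h : 'rV[R]_n -> R[i]).

(** All Fejer means of h vanish, and they converge to h. *)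
Lemma fourier_uniqueness h : torus_contC h ->
  (forall nu, torus_int (fun x => h x * chi nu x) = 0) -> forall x, h x = 0.
Proof.
move=> ch h0 x; apply/eq0_normc/eqP; rewrite -normr_le0 ger0_norm ?normc_ge0//.
apply/ler_addgt0Pl => e e0; rewrite addr0.
have [N _ /(_ N (leqnn N) x)] := fejer_approx ch e0.
rewrite trig_fejer big1 => [|p _]; last first.
  by rewrite fourier_coefE h0 !mulr0 mul0r.
by rewrite mulr0 sub0r (@normcN R).
Qed.

Lemma trig_lam_fejer N f x : torus_C 2 f ->
  trig lam (fejer_seq N f) x = - trig (fun=> 1) (fejer_seq N (laplacian f)) x.
Proof.
move=> f2; rewrite !trig_fejer -mulrN -sumrN; congr (_ * _).
apply: eq_bigr => p _; rewrite fourier_coef_laplacian// mul1r.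
by rewrite !mulNr opprK.
Qed.

(** Together with concatenation, it presents the difference of two Fejer means as a single list, to
    which [moment_bound] applies. *)
Definition trig_opp (p : seq (R[i] * 'rV[int]_n)) := [seq (- q.1, q.2) | q <- p].

Lemma trig_cat_opp m (p q : seq (R[i] * 'rV[int]_n)) x :
  trig m (p ++ trig_opp q) x = trig m p x - trig m q x.
Proof.
rewrite /trig big_cat big_map /= -sumrN; congr (_ + _).
by apply: eq_bigr => r _; rewrite mulrN mulNr.
Qed.

(** Errors e / 6 for f and for its Laplacian give P = Q = e / 3 in [moment_bound], hence 2 P + Q =
    e. N0 is fixed before s and x. *)
Lemma fejer_frac_cauchy f : torus_C 2 f -> forall e : R, 0 < e ->
  exists N0, forall N M, (N0 <= N)%N -> (N0 <= M)%N ->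
  forall s x, 0 < s -> s < 2 ->
  normc (trig (symbol s) (fejer_seq N f) x - trig (symbol s) (fejer_seq M f) x) <= e.
Proof.
move=> f2 e e0; have e6 : 0 < e / 6 by rewrite divr_gt0.
have [N1 _ fN1] := fejer_approx (torus_C0 f2) e6.
have [N2 _ fN2] := fejer_approx (torus_contC_laplacian f2) e6.
exists (maxn N1 N2) => N M; rewrite !geq_max => /andP[N1N N2N] /andP[N1M N2M] s x s0 s2.
have b1 : 1 < 2 / s by rewrite ltr_pdivlMr// mul1r.
have sub g (N' : nat) : torus_contC g -> (forall k, (N' <= k)%N -> forall x,
      normc (trig (fun=> 1) (fejer_seq k g) x - g x) <= e / 6) ->
    forall k l, (N' <= k)%N -> (N' <= l)%N -> forall y,
    normc (trig (fun=> 1) (fejer_seq k g) y - trig (fun=> 1) (fejer_seq l g) y) <= e / 3.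
  move=> cg gN' k l kN lN y; apply: le_trans (normc_dist (g y) _ _) _.
  rewrite (_ : e / 3 = e / 6 + e / 6); last by field.
  by apply: lerD; [exact: gN'|rewrite normcB; exact: gN'].
have := @moment_bound R n (fejer_seq N f ++ trig_opp (fejer_seq M f)) (e / 3) (e / 3) (2 / s) b1.
rewrite (_ : (fun nu => lam nu `^ (2 / s)^-1) = symbol s); last first.
  by apply/funext => nu; rewrite symbol_lam invf_div.
move=> /(_ _ _ x); rewrite trig_cat_opp (_ : 2 * (e / 3) + e / 3 = e); last by field.
apply => y; rewrite trig_cat_opp.
  exact: (sub f N1 (torus_C0 f2) fN1).
rewrite !trig_lam_fejer// -opprD (@normcN R).
exact: (sub _ N2 (torus_contC_laplacian f2) fN2).
Qed.

Lemma complex_cauchy (a : nat -> R[i]) :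
  (forall e : R, 0 < e -> exists N0, forall N M, (N0 <= N)%N -> (N0 <= M)%N ->
     normc (a N - a M) <= e) ->
  exists L, forall e : R, 0 < e -> exists N0, forall N, (N0 <= N)%N -> normc (L - a N) <= e.
Proof.
move=> ca; have comp (g : R[i] -> R) : (forall z w, `|g z - g w| <= normc (z - w)) ->
    cvg (g (a N) @[N --> \oo]).
  move=> g1; apply/cauchy_cvgP; apply: cauchy_exP => e e0.
  have [N0 aN0] := ca _ (divr_gt0 e0 (ltr0Sn R 1)).
  exists (g (a N0)); exists N0 => //= N N0N.
  rewrite /ball /=; apply: le_lt_trans (g1 _ _) _.
  apply: le_lt_trans (aN0 N0 N _ _) _ => //.
  by rewrite ltr_pdivrMr// ltr_pMr// ltr1n.
have gRe (z w : R[i]) : `|Re z - Re w| <= normc (z - w).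
  by have := ler_Re_normc (z - w); case: z w => ? ? [].
have gIm (z w : R[i]) : `|Im z - Im w| <= normc (z - w).
  by have := ler_Im_normc (z - w); case: z w => ? ? [].
have /cvg_ex[l1 c1] := comp (fun z => Re z) gRe.
have /cvg_ex[l2 c2] := comp (fun z => Im z) gIm.
exists (l1 +i* l2) => e e0; have e2 : 0 < e / 2 by rewrite divr_gt0.
have n1 : \forall N \near \oo, `|l1 - Re (a N)| <= e / 2.
  by move/cvgrPdist_le : c1; exact.
have n2 : \forall N \near \oo, `|l2 - Im (a N)| <= e / 2.
  by move/cvgrPdist_le : c2; exact.
have [N0 _ aN0] := filterI n1 n2; exists N0 => N /aN0 []; case: (a N) => q r h1 h2.
by apply: le_trans (normc_le_ReIm _) _; rewrite [leRHS]splitr; exact: lerD.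
Qed.

(** [get] returns some continuous representative; characters are test functions, so it has the same
    Fourier coefficients as g. *)
Lemma frac_lap_unique (s : R) f g :
  torus_C 0 g -> (forall phi, torus_smooth phi -> frac_lap_distr s f phi = fun_distr g phi) ->
  frac_lap s f = g.
Proof.
move=> g0 gP; rewrite /frac_lap; set G := [set _ | _].
have [h0 hP] : G (get G) by apply: (@getPex _ G); exists g.
have ch := (torus_contCP _).1 h0; have cg := (torus_contCP _).1 g0.
apply/funext => x; apply/eqP; rewrite -subr_eq0; apply/eqP; move: x.
apply: fourier_uniqueness => [|nu]; first exact: torus_contCB.
have : fun_distr (get G) (chi nu) = fun_distr g (chi nu).
  by rewrite -hP ?gP//; exact: torus_smooth_chi.
move=> hg; rewrite (_ : (fun x => _) = (fun x => get G x * chi nu x - g x * chi nu x)).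
  by rewrite torus_intB; [apply/eqP; rewrite subr_eq0; exact/eqP|exact: torus_contC_coef..].
by apply/funext => x; rewrite mulrBl.
Qed.

Lemma frac_lap_approx f : torus_C 2 f -> forall e : R, 0 < e ->
  exists N0, forall N, (N0 <= N)%N -> forall s x, 0 < s -> s < 2 ->
  normc (frac_lap s f x - trig (symbol s) (fejer_seq N f) x) <= e.
Proof.
move=> f2; have cf := torus_C0 f2; have fC := fejer_frac_cauchy f2.
pose a s N x := trig (symbol s) (fejer_seq N f) x.
(* Convergence at fixed s and x, without a rate, is enough: letting the second index grow in the
   Cauchy estimate restores uniformity. *)
suff H s : 0 < s -> s < 2 ->
    forall x (e : R), 0 < e -> exists N0, forall N, (N0 <= N)%N ->
      normc (frac_lap s f x - a s N x) <= e.
  move=> e e0; have e2 : 0 < e / 2 by rewrite divr_gt0.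
  have [N0 aN0] := fC _ e2; exists N0 => N N0N s x s0 s2.
  have [N1 aN1] := H s s0 s2 x _ e2.
  apply: le_trans (normc_dist (a s (maxn N0 N1) x) _ _) _.
  rewrite [leRHS]splitr; apply: lerD; first exact/aN1/leq_maxr.
  by apply: aN0 => //; exact: leq_maxl.
move=> s0 s2.
have /choice[g gP] : forall x, exists L, forall e : R, 0 < e ->
    exists N0, forall N, (N0 <= N)%N -> normc (L - a s N x) <= e.
  move=> x; apply: complex_cauchy => e /fC[N0 aN0]; exists N0 => N M NN MM.
  exact: aN0.
have gU (e : R) : 0 < e -> exists N0, forall N, (N0 <= N)%N -> forall x,
    normc (g x - a s N x) <= e.
  move=> e0; have e2 : 0 < e / 2 by rewrite divr_gt0.
  have [N0 aN0] := fC _ e2; exists N0 => N N0N x; have [N1 aN1] := gP x _ e2.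
  apply: le_trans (normc_dist (a s (maxn N0 N1) x) _ _) _.
  rewrite [leRHS]splitr; apply: lerD; first exact/aN1/leq_maxr.
  by apply: aN0 => //; exact: leq_maxl.
have ca N : torus_contC (a s N) by exact: torus_contC_trig.
have cg : torus_contC g.
  apply: torus_contC_unif_lim => e /gU[N0 aN0]; exists (a s N0) => // x.
  exact: aN0.
suff -> : frac_lap s f = g by [].
apply: frac_lap_unique => [|phi sphi]; first exact/torus_contCP.
have cphi : torus_contC phi := torus_C0 (sphi 0%N).
have cF : torus_contC (frac_lap_smooth s phi) := torus_contC_frac_lap_smooth s0 (ltW s2) sphi.
have [M1 phiM1] := torus_contC_bounded cphi; have [M2 FM2] := torus_contC_bounded cF.
have M10 : 0 <= M1 by apply: le_trans (phiM1 0); exact: normc_ge0.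
have M20 : 0 <= M2 by apply: le_trans (FM2 0); exact: normc_ge0.
have p0 : 0 < (2 * pi) ^+ n :> R by rewrite exprn_gt0 ?twopi_gt0.
apply/eqP; rewrite -subr_eq0; apply/eqP/eq0_normc/eqP.
rewrite -normr_le0 ger0_norm ?normc_ge0//; apply/ler_addgt0Pl => e e0; rewrite addr0.
(* M2 weighs the error on f, M1 the error on g; the 1 keeps K positive. *)
pose K := (2 * pi) ^+ n * (M1 + M2 + 1).
have K0 : 0 < K by rewrite mulr_gt0// ltr_wpDl// addr_ge0.
have eK : 0 < e / K by rewrite divr_gt0.
have [N1 gN1] := gU _ eK; have [N2 _ fN2] := fejer_approx cf eK.
pose N := maxn N1 N2; pose b := trig (fun=> 1) (fejer_seq N f).
have cb : torus_contC b by exact: torus_contC_trig.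
rewrite /frac_lap_distr /fun_distr.
apply: le_trans (normc_dist (torus_int (fun x => b x * frac_lap_smooth s phi x)) _ _) _.
have -> : e = (2 * pi) ^+ n * (e / K * M2) + (2 * pi) ^+ n * (e / K * (M1 + 1)).
  by rewrite /K; field; rewrite !gt_eqF// ltr_wpDl// addr_ge0.
apply: lerD.
  rewrite -torus_intB; [|exact: torus_contCM|exact: torus_contCM].
  apply: normc_torus_int_le => [|x]; first by apply: torus_contCB; exact: torus_contCM.
  rewrite -mulrBl normcM; apply: ler_pM; rewrite ?normc_ge0// normcB.
  by apply: fN2; exact: leq_maxr.
(* Duality moves the symbol from phi to the Fejer mean, turning [b] into [a s N]. *)
rewrite frac_lap_smooth_dual ?(ltW s2)//.
rewrite -torus_intB; [|exact: torus_contCM (ca N) cphi|exact: torus_contCM].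
apply: normc_torus_int_le => [|x].
  by apply: torus_contCB; [exact: torus_contCM (ca N) cphi|exact: torus_contCM].
rewrite -mulrBl normcM; apply: ler_pM; rewrite ?normc_ge0//.
  by rewrite normcB; apply: gN1; exact: leq_maxl.
by apply: le_trans (phiM1 x) _; rewrite lerDl.
Qed.

Lemma symbol_cvg (nu : 'rV[int]_n) : symbol s nu - lam nu @[s --> (2 : R)^'-] --> (0 : R).
Proof.
have l0 := @lam_ge0 R n nu; move: l0; rewrite le_eqVlt => /predU1P[l0|l0].
  (* At the zero frequency the power is 0 as soon as s > 0, which holds near 2. *)
  apply: cvg_near_cst; apply: filterS (nbhs_left_gt (@ltr0Sn R 1)) => s s0.
  by rewrite symbol_lam -l0 subr0 powR0// gt_eqF// divr_gt0.
have cexp : expR (s / 2 * ln (lam nu)) @[s --> (2 : R)^'-] --> expR (2 / 2 * ln (lam nu)).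
  apply: cvg_at_left_filter.
  apply: (@cvg_comp _ _ _ (fun s : R => s / 2 * ln (lam nu)) expR _ _ _ _ (@continuous_expR R _)).
  by apply: cvgM; [apply: cvgM; [exact: cvg_id|exact: cvg_cst]|exact: cvg_cst].
have : expR (s / 2 * ln (lam nu)) - lam nu @[s --> (2 : R)^'-] -->
    expR (2 / 2 * ln (lam nu)) - lam nu by apply: cvgB; [exact: cexp|exact: cvg_cst].
rewrite divff// mul1r lnK ?posrE// subrr.
rewrite (_ : (fun s => symbol s nu - lam nu) = (fun s => expR (s / 2 * ln (lam nu)) - lam nu))//.
by apply/funext => s; rewrite symbol_lam /powR gt_eqF.
Qed.

End FracLaplacian.

Unset Implicit Arguments.
Set Strict Implicit.

Theorem proposition5p3 (R : realType) (n : nat) (n_ge1 : (1 <= n)%N)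
    (f : 'rV[R]_n -> R[i]) (fC2 : torus_C 2 f) (x : 'rV[R]_n) :
  (frac_lap s f x : R[i]^o) @[s --> (2 : R)^'-] --> (- laplacian f x : R[i]^o).
Proof.
apply/cvgcP => e e0; have e3 : 0 < e / 3 by rewrite divr_gt0.
have [N1 fracN1] := frac_lap_approx fC2 e3.
have [N2 _ lapN2] := fejer_approx (torus_contC_laplacian fC2) e3.
(* N is fixed before s, thanks to a rate uniform in s; for this fixed finite list [E s] bounds sup
   |A^(s/2) p - A p|. *)
pose N := maxn N1 N2; pose p := fejer_seq N f.
pose E s := \sum_(q <- p) `|symbol s q.2 - lam q.2| * normc q.1.
have E0 : E s @[s --> (2 : R)^'-] --> (0 : R).
  apply: cvg_sum0 => q.
  have H : `|symbol s q.2 - lam q.2| @[s --> (2 : R)^'-] --> `|0 : R|.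
    by apply: cvg_norm; exact: symbol_cvg.
  have : `|symbol s q.2 - lam q.2| * normc q.1 @[s --> (2 : R)^'-] --> `|0 : R| * normc q.1.
    by apply: cvgM; [exact: H|exact: cvg_cst].
  by rewrite normr0 mul0r; exact.
have Ee : \forall s \near (2 : R)^'-, `|0 - E s| <= e / 3.
  by move/cvgrPdist_le : E0; exact.
near=> s.
have s0 : 0 < s by near: s; exact: nbhs_left_gt.
have s2 : s < 2 by near: s; exact: nbhs_left_lt.
have Es : E s <= e / 3.
  apply: le_trans (ler_norm _) _; rewrite -normrN -[- E s]add0r.
  by near: s.
have -> : e = e / 3 + (e / 3 + e / 3) by field.
apply: le_trans (normc_dist (trig lam p x) _ _) _; apply: lerD.
  have lapE : - laplacian f x - trig lam p x =
      trig (fun=> 1) (fejer_seq N (laplacian f)) x - laplacian f x.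
    by rewrite trig_lam_fejer// opprK addrC.
  by have := lapN2 N (leq_maxr _ _) x; rewrite -lapE; exact.
apply: le_trans (normc_dist (trig (symbol s) p x) _ _) _; apply: lerD.
  rewrite normcB; apply: le_trans Es; rewrite -sumrB.
  apply: le_trans (normc_sum _ _ _) _; apply: ler_sum => q _.
  by rewrite -!mulrBl -rmorphB !normcM normc_chi normc_real mulr1.
by rewrite normcB; apply: fracN1 => //; exact: leq_maxl.
Unshelve. all: by end_near. Qed.
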